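(* Assume that $\mathfrak c=2^{\aleph_0}$ is a regular cardinal. Let $\mathfrak B$ be the Boolean algebra, unique up to isomorphism, such that $|\mathfrak B|=\mathfrak c$, $\mathfrak B$ is tightly $\sigma$-filtered, and for all embeddings of Boolean algebras $u:A\to\mathfrak B$, $v:A\to B$ with $|A|<\mathfrak c$ and $v$ posex there exists an embedding $\tilde u:B\to\mathfrak B$ with $\tilde u v=u$. Let $\mathfrak K=St(\mathfrak B)$ be its Stone space, and let $p,q\in\mathfrak K$ be $P$-points. Then there exists a homeomorphism $f:\mathfrak K\to\mathfrak K$ such that $f(p)=q$.
   Context: A point $p$ of a topological space $K$ is a $P$-point if the intersection of countably many neighborhoods of $p$ always contains a neighborhood of $p$. Embeddings of Boolean algebras are one-to-one Boolean homomorphisms. For $H\subset B$, $\langle H\rangle$ is the subalgebra generated by $H$. Push-out: let $S,A$ be subalgebras of a Boolean algebra $B$. $B$ is the internal push-out of $S$ and $A$, written $B=\mathbf{PO}[S,A]$, if (i) $B=\langle S\cup A\rangle$, and (ii) for every $a\in A$ and $s\in S$ with $a\le s$ there exists $r\in A\cap S$ with $a\le r\le s$. Posex: if $A$ is a subalgebra of $B$, $B$ is a posex of $A$ if there is a countable subalgebra $S\subset B$ with $B=\mathbf{PO}[S,A]$. An embedding $v:A\to B$ is posex if $B$ is a posex of $v(A)$. A Boolean algebra $\mathfrak B$ is tightly $\sigma$-filtered if there exist an ordinal $\lambda$ and subalgebras $\{B_\alpha:\alpha\le\lambda\}$ of $\mathfrak B$ such that $B_\alpha\subset B_\beta$ for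 $\alpha<\beta\le\lambda$; $B_0=\{0,1\}$ and $B_\lambda=\mathfrak B$; $B_{\alpha+1}$ is a posex of $B_\alpha$ for every $\alpha<\lambda$; and $B_\beta=\bigcup_{\alpha<\beta}B_\alpha$ for every limit ordinal $\beta\le\lambda$. The existence and uniqueness up to isomorphism of $\mathfrak B$ (for $\mathfrak c$ regular) is a theorem of the same paper. *)

(* Defs.v *)
From HB Require Import structures.
From mathcomp Require Import all_boot all_order.
From mathcomp Require wochoice.
From mathcomp Require Import boolp classical_sets functions cardinality filter.
From mathcomp Require Import topology.

Set Implicit Arguments.
Unset Strict Implicit.
Unset Printing Implicit Defensive.

Import Order.Theory.

Local Open Scope classical_set_scope.
Local Open Scope card_scope.

(* Boolean algebras are the complemented bounded distributive lattices
   [ctbDistrLatticeType d]; [d] is only the display parameter of the order. *)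

(* [{tblmorphism A -> B}] is not used for homomorphisms: it only asks for the
   preservation of \bot and \top, not of meets and joins. *)
Definition boolean_hom (dA dB : Order.disp_t) (A : ctbDistrLatticeType dA)
    (B : ctbDistrLatticeType dB) (f : A -> B) : Prop :=
  [/\ f \bot%O = \bot%O, f \top%O = \top%O,
      forall x y, f (Order.meet x y) = Order.meet (f x) (f y),
      forall x y, f (Order.join x y) = Order.join (f x) (f y)
    & forall x, f (Order.compl x) = Order.compl (f x)].

Definition embedding (dA dB : Order.disp_t) (A : ctbDistrLatticeType dA)
    (B : ctbDistrLatticeType dB) (f : A -> B) : Prop :=
  boolean_hom f /\ injective f.

Definition subalgebra (d : Order.disp_t) (B : ctbDistrLatticeType d)
    (S : set B) : Prop :=
  [/\ S \bot%O, S \top%O,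
      forall x y, S x -> S y -> S (Order.meet x y),
      forall x y, S x -> S y -> S (Order.join x y)
    & forall x, S x -> S (Order.compl x)].

Definition generated (d : Order.disp_t) (B : ctbDistrLatticeType d)
    (H : set B) : set B :=
  smallest (@subalgebra d B) H.

(* [C = PO[S, A]], where the three algebras [C], [S], [A] are given as
   subalgebras of an ambient Boolean algebra [B].  Since [C] is a subalgebra,
   generating inside [C] or inside [B] is the same. *)
Definition pushout (d : Order.disp_t) (B : ctbDistrLatticeType d)
    (C S A : set B) : Prop :=
  [/\ [/\ subalgebra C, subalgebra S & subalgebra A],
      S `<=` C /\ A `<=` C,
      C = generated (S `|` A)
    & forall a s, A a -> S s -> (a <= s)%O ->
        exists r, [/\ A r, S r, (a <= r)%O & (r <= s)%O]].

Definition posex (d : Order.disp_t) (B : ctbDistrLatticeType d)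
    (C A : set B) : Prop :=
  exists S : set B, countable S /\ pushout C S A.

Definition posex_embedding (dA dB : Order.disp_t) (A : ctbDistrLatticeType dA)
    (B : ctbDistrLatticeType dB) (v : A -> B) : Prop :=
  embedding v /\ posex [set: B] (range v).

Definition is_succ (d : Order.disp_t) (I : porderType d) (i j : I) : Prop :=
  (i < j)%O /\ forall k, (i < k)%O -> (j <= k)%O.

Definition is_limit (d : Order.disp_t) (I : bPOrderType d) (j : I) : Prop :=
  j <> \bot%O /\ forall i, ~ is_succ i j.

(* The index set {alpha : alpha <= lambda} is a well-ordered type [I] with a
   greatest element: \bot is the ordinal 0 and \top is lambda. *)
Definition tightly_sigma_filtered (d : Order.disp_t)
    (B : ctbDistrLatticeType d) : Prop :=
  exists (dI : Order.disp_t) (I : tbOrderType dI) (F : I -> set B),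
    wochoice.well_order (fun i j : I => (i <= j)%O) /\
    [/\ forall i, subalgebra (F i),
        forall i j, (i < j)%O -> F i `<=` F j,
        F \bot%O = [set \bot%O; \top%O] /\ F \top%O = [set: B],
        forall i j, is_succ i j -> posex (F j) (F i)
      & forall j, is_limit j -> F j = \bigcup_(i in [set i | (i < j)%O]) F i].

Definition card_lt (T U : Type) (A : set T) (B : set U) : Prop :=
  A #<= B /\ A #!= B.

(* The order type of [R] is the initial ordinal of cardinality |T|. *)
Definition initial_well_order (T : Type) (R : rel T) : Prop :=
  wochoice.well_order R /\
  forall x, card_lt [set y | R y x /\ y <> x] [set: T].

(* |T| is an infinite cardinal equal to its own cofinality. *)
Definition regular_cardinal (T : Type) : Prop :=
  infinite_set [set: T] /\
  forall R : rel T, initial_well_order R ->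
    forall C : set T, (forall x, exists2 y, C y & R x y) -> C #= [set: T].

Definition ba_proper_filter (d : Order.disp_t) (B : ctbDistrLatticeType d)
    (F : set B) : Prop :=
  [/\ F \top%O, ~ F \bot%O,
      forall x y, F x -> F y -> F (Order.meet x y)
    & forall x y, (x <= y)%O -> F x -> F y].

Definition ba_ultrafilter (d : Order.disp_t) (B : ctbDistrLatticeType d)
    (F : set B) : Prop :=
  ba_proper_filter F /\ forall G, ba_proper_filter G -> F `<=` G -> G = F.

Record Stone (d : Order.disp_t) (B : ctbDistrLatticeType d) : Type :=
  MkStone { stone_set : set B ; stone_setP : ba_ultrafilter stone_set }.

Definition stone_clopen (d : Order.disp_t) (B : ctbDistrLatticeType d)
    (a : B) : set (Stone B) :=
  [set p | stone_set p a].

Lemma stone_cover (d : Order.disp_t) (B : ctbDistrLatticeType d) :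
  \bigcup_(U in range (@stone_clopen d B)) U = [set: Stone B].
Proof.
apply/seteqP; split=> // p _.
exists (stone_clopen \top%O); first by exists \top%O.
by case: (stone_setP p) => -[].
Qed.

Lemma stone_join (d : Order.disp_t) (B : ctbDistrLatticeType d)
    (U V : set (Stone B)) (p : Stone B) :
  range (@stone_clopen d B) U -> range (@stone_clopen d B) V -> U p -> V p ->
  exists W, [/\ range (@stone_clopen d B) W, W p & W `<=` U `&` V].
Proof.
move=> [a _ <-] [b _ <-] pa pb; exists (stone_clopen (Order.meet a b)).
split; first by exists (Order.meet a b).
- by case: (stone_setP p) => -[_ _ pI _] _; exact: pI.
- move=> q qab; case: (stone_setP q) => -[_ _ _ qU] _; split.
  + exact: (qU _ _ (leIl a b) qab).
  + exact: (qU _ _ (leIr b a) qab).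
Qed.

HB.instance Definition _ (d : Order.disp_t) (B : ctbDistrLatticeType d) :=
  gen_eqMixin (Stone B).
HB.instance Definition _ (d : Order.disp_t) (B : ctbDistrLatticeType d) :=
  gen_choiceMixin (Stone B).
HB.instance Definition _ (d : Order.disp_t) (B : ctbDistrLatticeType d) :=
  @isBaseTopological.Build (Stone B) (set (Stone B)) (range (@stone_clopen d B))
    id (@stone_cover d B) (@stone_join d B).

Definition P_point (K : topologicalType) (p : K) : Prop :=
  forall U : nat -> set K, (forall n, nbhs p (U n)) -> nbhs p (\bigcap_n U n).

Definition homeomorphism (K L : topologicalType) (f : K -> L) : Prop :=
  exists g : L -> K, [/\ cancel f g, cancel g f, continuous f & continuous g].

(* Main.v *)
(* Writing \mathfrak B as an increasing union of push-outs with countable algebras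
   S_i, call a set M of steps closed if S_i meets the algebra of the earlier
   steps inside the algebra spanned by the earlier steps in M, for all i in M.
   The algebras spanned by closed sets are stable under joins and any two of them
   interpolate each other, so each one followed by a countable extension is a
   push-out: this makes a back-and-forth of length c possible, which produces an
   automorphism. To make it carry p to q, let C be the push-out of a small algebra
   A and a countable S, and let u embed C into \mathfrak B extending the current
   partial isomorphism. As q is a P-point, some c in q lies below all elements
   of q in u(S); replacing u(s) by u(s) - c or u(s) + c according to whether s
   belongs to p gives an extension that matches p with q. It stays injective
   once c is also chosen with no nonzero element of u(C) below it, which is
   achieved by intersecting c with an element independent of u(C) or with its
   complement. *)
Require Import Defs.
From HB Require Import structures.
From mathcomp Require Import all_boot all_order.
From mathcomp Require wochoice.
From mathcomp Require Import boolp classical_sets functions cardinality filter.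
From mathcomp Require Import topology.

Set Implicit Arguments.
Unset Strict Implicit.
Unset Printing Implicit Defensive.

Import Order.Theory.

Local Open Scope classical_set_scope.
Local Open Scope card_scope.

(** * Ultrafilters as two-valued homomorphisms *)

Section Ultrafilters.
Variables (d : Order.disp_t) (B : ctbDistrLatticeType d).
Implicit Types (F G : set B) (x y : B) (r : Stone B).

Lemma ultrafilter_prime F : ba_ultrafilter F -> forall x, F x \/ F (~` x)%O.
Proof.
(* [G] is the filter generated by [F] and [x]: if it is improper, some element of [F] is disjoint
   from [x]; otherwise maximality gives [G = F]. *)
move=> [[F1 F0 FI FU] Fmax] x; pose G := [set y | exists2 z, F z & (z `&` x <= y)%O].
have sFG : F `<=` G by move=> y Fy; exists y => //; exact: leIl.
have Gx : G x by exists \top%O => //; exact: leIr.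
have [G0|G0] := pselect (G \bot%O).
  by right; case: G0 => z Fz; rewrite lex0 => /eqP zx; apply: FU Fz; rewrite -disj_leC zx.
left; rewrite -(Fmax G) //; split => //.
- exact: sFG.
- move=> y z [y' Fy yy] [z' Fz zz]; exists (y' `&` z')%O; first exact: FI.
  rewrite lexI (le_trans _ yy) ?(le_trans _ zz) //.
    by rewrite leI2 // leIr.
  by rewrite leI2 // leIl.
- by move=> y z yz [y' Fy yy]; exists y' => //; exact: le_trans yz.
Qed.

Lemma prime_ultrafilter F :
  ba_proper_filter F -> (forall x, F x \/ F (~` x)%O) -> ba_ultrafilter F.
Proof.
move=> Ffil Fpr; split=> // G [_ G0 GI _] sFG; apply/seteqP; split=> // x Gx.
have [//|Fx] := Fpr x; case: G0; rewrite -(meetxC x); exact: GI (sFG _ Fx).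
Qed.

Lemma ultrafilter_exists x : x <> \bot%O -> exists r, stone_set r x.
Proof.
move=> x0; pose P F := F = set0 \/ ba_proper_filter F /\ F x.
have Pup : P [set y | x <= y]%O.
  right; split; last exact: lexx.
  split => /=; first exact: lex1.
  - by rewrite lex0 => /eqP.
  - by move=> y z xy xz; rewrite lexI xy.
  - by move=> y z yz /le_trans; apply.
have [C CP Ctot|F [[F0|[Ffil Fx]]] Fmax] := @Zorn_bigcup B P.
- have [[X CX [y Xy]]|C0] := pselect (exists2 X, C X & X !=set0); last first.
    left; apply/seteqP; split=> // y [X CX Xy]; case: C0.
    by exists X => //; exists y.
  have CP' Y z : C Y -> Y z -> ba_proper_filter Y /\ Y x.
    by move=> CY Yz; case: (CP Y CY) => // Y0; rewrite Y0 in Yz.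
  right; split; last by have [] := CP' _ _ CX Xy; exists X.
  split.
  + by have [[]] := CP' _ _ CX Xy; exists X.
  + by move=> [Y CY Y0]; have [[]] := CP' _ _ CY Y0.
  + move=> a b [Y CY Ya] [Z CZ Zb].
    have [YZ|ZY] := Ctot _ _ CY CZ.
      by exists Z => //; have [[_ _ + _] _] := CP' _ _ CZ Zb; apply=> //; exact: YZ.
    by exists Y => //; have [[_ _ + _] _] := CP' _ _ CY Ya; apply=> //; exact: ZY.
  + move=> a b ab [Y CY Ya]; exists Y => //.
    by have [[_ _ _ YU] _] := CP' _ _ CY Ya; exact: YU ab Ya.
- case: (Fmax [set y | x <= y]%O) => //; rewrite F0; split=> // /(_ x); apply.
  exact: lexx.
- suff uF : ba_ultrafilter F by exists (MkStone uF).
  split=> // G Gfil sFG; apply: contrapT => GF.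
  apply: (Fmax G); last by right; split=> //; exact: sFG.
  by split=> // sGF; apply: GF; apply/seteqP.
Qed.

Definition ev r x : bool := `[< stone_set r x >].

Lemma evP r x : reflect (stone_set r x) (ev r x).
Proof. exact: asboolP. Qed.

Lemma ev_top r : ev r \top%O = true.
Proof. by apply/evP; case: (stone_setP r) => -[]. Qed.

Lemma ev_bot r : ev r \bot%O = false.
Proof. by apply/evP; case: (stone_setP r) => -[]. Qed.

Lemma ev_meet r x y : ev r (x `&` y)%O = ev r x && ev r y.
Proof.
case: (stone_setP r) => -[_ _ rI rU] _.
apply/evP/andP => [rxy|[/evP rx /evP ry]]; last exact: rI.
by split; apply/evP; apply: rU rxy; rewrite ?leIl ?leIr.
Qed.

Lemma ev_compl r x : ev r (~` x)%O = ~~ ev r x.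
Proof.
apply/evP/idP => [rx|/negP rx].
  apply/negP => /evP; case: (stone_setP r) => -[_ r0 rI _] _ rx'.
  by apply: r0; rewrite -(meetxC x); exact: rI.
by case: (ultrafilter_prime (stone_setP r) x) => // /evP.
Qed.

Lemma ev_join r x y : ev r (x `|` y)%O = ev r x || ev r y.
Proof. by rewrite -[(x `|` y)%O]complK complU ev_compl ev_meet !ev_compl -negb_or negbK. Qed.

Definition evE := (ev_top, ev_bot, ev_meet, ev_compl, ev_join).

Lemma ev_le x y : (x <= y)%O -> forall r, ev r x ==> ev r y.
Proof.
move=> xy r; apply/implyP => /evP rx; apply/evP.
by case: (stone_setP r) => -[_ _ _ rU] _; exact: rU rx.
Qed.

(** Otherwise the meet of [x] with the complement of [y] is nonzero, and an ultrafilter through it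
    separates them. *)
Lemma le_ev x y : (forall r, ev r x ==> ev r y) -> (x <= y)%O.
Proof.
move=> H; rewrite -[y]complK -disj_leC; apply/eqP.
apply: contrapT => /ultrafilter_exists[r /evP]; have := H r; rewrite !evE.
by case: (ev r x); case: (ev r y).
Qed.

Lemma eq_ev x y : (forall r, ev r x = ev r y) -> x = y.
Proof. by move=> H; apply/eqP; rewrite eq_le !le_ev // => r; rewrite H implybb. Qed.

End Ultrafilters.

(* Decides consequences of Boolean (in)equalities by evaluating both sides at
   all ultrafilters. *)
Ltac ba :=
  let r := fresh "r" in
  (apply: le_ev || apply: eq_ev) => r;
  repeat match goal with
  | H : is_true (@Order.le _ _ _ _) |- _ => move: (ev_le H r); clear H
  | H : @eq _ _ _ |- _ =>
      let E := constr:(congr1 (ev r) H) in move: E; clear H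
  end;
  rewrite ?evE;
  repeat match goal with
  | |- context [ev r ?x] => case: (ev r x)
  end; by [].

(** * Generated subalgebras and interpolation *)

Lemma countableU (T : Type) (X Y : set T) :
  countable X -> countable Y -> countable (X `|` Y).
Proof.
move=> Xc Yc; rewrite -bigcup2E; apply: bigcup_countable => // -[|[|i]] _ //=.
Qed.

Section Subalgebras.
Variables (d : Order.disp_t) (B : ctbDistrLatticeType d).
Implicit Types (A H S T : set B) (x y z : B).

Lemma generated_subalgebra H : subalgebra (generated H).
Proof.
split.
- by move=> C [[]].
- by move=> C [[]].
- move=> x y Hx Hy C HC; have [[_ _ CI _ _] _] := HC.
  by apply: CI; [exact: Hx|exact: Hy].
- move=> x y Hx Hy C HC; have [[_ _ _ CU _] _] := HC.
  by apply: CU; [exact: Hx|exact: Hy].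
- by move=> x Hx C HC; have [[_ _ _ _ CC] _] := HC; apply: CC; exact: Hx.
Qed.

Lemma sub_generated H : H `<=` generated H.
Proof. exact: sub_gen_smallest. Qed.

Lemma generated_min H S : subalgebra S -> H `<=` S -> generated H `<=` S.
Proof. exact: smallest_sub. Qed.

Lemma generated_mono H T : H `<=` T -> generated H `<=` generated T.
Proof. by move=> HT; apply: sub_smallest2r => //; exact: generated_subalgebra. Qed.

Lemma subalgebra_generated S : subalgebra S -> generated S = S.
Proof.
by move=> SS; apply/seteqP; split; [exact: generated_min|exact: sub_generated].
Qed.

Lemma generated_setUl H T : generated (generated H `|` T) = generated (H `|` T).
Proof.
apply/seteqP; split.
  apply: generated_min; first exact: generated_subalgebra.
  rewrite subUset; split; first by apply: generated_mono; exact: subsetUl.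
  by apply: subset_trans (@sub_generated _); exact: subsetUr.
by apply: generated_mono; apply: setSU; exact: sub_generated.
Qed.

Lemma subalgebra_chain (C : set (set B)) : C !=set0 ->
  (forall X, C X -> subalgebra X) -> total_on C subset ->
  subalgebra (\bigcup_(X in C) X).
Proof.
move=> [X0 CX0] CS Ctot.
have join2 x y : (\bigcup_(X in C) X) x -> (\bigcup_(X in C) X) y ->
    exists X, [/\ C X, X x & X y].
  move=> [X CX Xx] [Y CY Yy].
  have [XY|YX] := Ctot _ _ CX CY; first by exists Y; split=> //; exact: XY.
  by exists X; split=> //; exact: YX.
split.
- by exists X0 => //; case: (CS _ CX0).
- by exists X0 => //; case: (CS _ CX0).
- move=> x y Ux Uy; have [X [CX Xx Xy]] := join2 _ _ Ux Uy.
  by exists X => //; have [_ _ + _ _] := CS _ CX; exact.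
- move=> x y Ux Uy; have [X [CX Xx Xy]] := join2 _ _ Ux Uy.
  by exists X => //; have [_ _ _ + _] := CS _ CX; exact.
- by move=> x [X CX Xx]; exists X => //; have [_ _ _ _ +] := CS _ CX; exact.
Qed.

Section TwoGenerators.
Variables (A S : set B).
Hypotheses (AA : subalgebra A) (SS : subalgebra S).

(** Disjunctive normal form for the algebra generated by two subalgebras, made inductive so as to
    yield an induction principle. *)
Inductive join_of_meets : B -> Prop :=
| JoM_meet a s : A a -> S s -> join_of_meets (a `&` s)%O
| JoM_join x y : join_of_meets x -> join_of_meets y -> join_of_meets (x `|` y)%O.

Lemma subalgebra_join_of_meets : subalgebra join_of_meets.
Proof.
have [A0 A1 AI AU AC] := AA; have [S0 S1 SI SU SC] := SS.
have JI x y : join_of_meets x -> join_of_meets y -> join_of_meets (x `&` y)%O.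
  elim=> [a s Aa Ss|x1 x2 _ IH1 _ IH2 Jy].
    elim=> [b t Ab St|y1 y2 _ IH1 _ IH2].
      by rewrite meetACA; apply: JoM_meet; [exact: AI|exact: SI].
    by rewrite meetUr; exact: JoM_join.
  by rewrite meetUl; apply: JoM_join; [exact: IH1|exact: IH2].
split=> //.
- by rewrite -(meetxx \bot%O); exact: JoM_meet.
- by rewrite -(meetxx \top%O); exact: JoM_meet.
- exact: JoM_join.
- move=> x; elim=> [a s Aa Ss|x1 x2 _ IH1 _ IH2]; last by rewrite complU; exact: JI.
  rewrite complI; apply: JoM_join.
    by rewrite -[(~` a)%O]meetx1; apply: JoM_meet => //; exact: AC.
  by rewrite -[(~` s)%O]meet1x; apply: JoM_meet => //; exact: SC.
Qed.

Lemma generated_join_ind (P : B -> Prop) :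
  (forall a s, A a -> S s -> P (a `&` s)%O) ->
  (forall x y, P x -> P y -> P (x `|` y)%O) ->
  forall x, generated (A `|` S) x -> P x.
Proof.
move=> Pm Pj x Gx.
suff: join_of_meets x by elim=> [a s|y z _ Py _ Pz]; [exact: Pm|exact: Pj].
apply: (generated_min subalgebra_join_of_meets _ Gx) => y [Ay|Sy].
  by rewrite -[y]meetx1; apply: JoM_meet => //; case: SS.
by rewrite -[y]meet1x; apply: JoM_meet => //; case: AA.
Qed.

Lemma generated_meet_ind (P : B -> Prop) :
  (forall a s, A a -> S s -> P (a `|` s)%O) ->
  (forall x y, P x -> P y -> P (x `&` y)%O) ->
  forall x, generated (A `|` S) x -> P x.
Proof.
have [_ _ _ _ AC] := AA; have [_ _ _ _ SC] := SS.
move=> Pm Pj x Gx; rewrite -[x]complK.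
have : generated (A `|` S) (~` x)%O by have [_ _ _ _] := generated_subalgebra (A `|` S); exact.
elim/generated_join_ind => [a s Aa Ss|y z Py Pz].
  by rewrite complI; apply: Pm; [exact: AC|exact: SC].
by rewrite complU; exact: Pj.
Qed.

End TwoGenerators.

(** The last clause of [pushout], used on its own for pairs that need not generate the ambient
    algebra. *)
Definition interpolates A S := forall a s, A a -> S s -> (a <= s)%O ->
  exists r, [/\ A r, S r, (a <= r)%O & (r <= s)%O].

(* An element [\join (a_i `&` s_i)] lies below [s] iff each [a_i] lies below
   [s `|` ~` s_i], which again belongs to [T]. *)
Lemma interpolates_generated A S T : subalgebra A -> subalgebra S ->
  subalgebra T -> S `<=` T -> interpolates A T ->
  interpolates (generated (A `|` S)) T.
Proof.
move=> AA SS TT ST AT x s Gx Ts.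
have [_ _ GI GU _] := generated_subalgebra (A `|` S).
have [_ _ TI TU TC] := TT.
move: x Gx; apply: generated_join_ind => // [a t Aa St|x y IHx IHy] xs.
  have [|||r [Ar Tr ar rs]] := AT a (s `|` ~` t)%O => //.
  - by apply: TU => //; apply: TC; exact: ST.
  - by ba.
  - exists (r `&` t)%O; split; try by ba.
    + by apply: GI; apply: sub_generated; [left|right].
    + by apply: TI => //; exact: ST.
have [|u [Gu Tu xu us]] := IHx; first by ba.
have [|v [Gv Tv yv vs]] := IHy; first by ba.
exists (u `|` v)%O; split; [exact: GU|exact: TU|by ba|by ba].
Qed.

(* What remains of membership in the skeleton (see below) after a countably
   generated extension. *)
Definition nice A := forall X, countable X ->
  exists S, [/\ subalgebra S, countable S, X `<=` S & interpolates A S].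

(** The witness for [X] is the one that [A] offers for [X] together with [S], so that
    [interpolates_generated] applies. *)
Lemma nice_generated A S : subalgebra A -> subalgebra S -> countable S ->
  nice A -> nice (generated (A `|` S)).
Proof.
move=> AA SS Sc nA X Xc.
have [T [TT Tc XST AT]] : exists T, [/\ subalgebra T, countable T, X `|` S `<=` T & interpolates A T].
  by apply: nA; exact: countableU.
exists T; split=> //; first by move=> x Xx; apply: XST; left.
by apply: interpolates_generated => //; move=> x Sx; apply: XST; right.
Qed.

(* Since all Boolean operations come from this one and [\bot], a generated
   subalgebra is covered by countably many images of squares, which bounds its
   cardinality. *)
Definition nand x y : B := (~` (x `&` y))%O.

Fixpoint nand_iter H n : set B :=
  if n is n'.+1 then nand_iter H n' `|` [set nand z.1 z.2 | z in nand_iter H n' `*` nand_iter H n']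
  else H.

Lemma nand_iter_le H m n : (m <= n)%N -> nand_iter H m `<=` nand_iter H n.
Proof.
elim: n => [|n IH]; first by rewrite leqn0 => /eqP->.
rewrite leq_eqVlt => /orP[/eqP->//|]; rewrite ltnS => /IH mn.
by apply: subset_trans mn _; exact: subsetUl.
Qed.

Lemma generated_sub_nand_iter H : H \bot%O -> generated H `<=` \bigcup_n nand_iter H n.
Proof.
move=> H0; set U := \bigcup_n _.
have UN x y : U x -> U y -> U (nand x y).
  move=> [m _ Hx] [n _ Hy]; exists (maxn m n).+1 => //; right; exists (x, y) => //.
  by split; [move: Hx|move: Hy]; apply: nand_iter_le; rewrite ?leq_maxl ?leq_maxr.
have UC x : U x -> U (~` x)%O by move=> Ux; rewrite -[x]meetxx; exact: UN.
have UI x y : U x -> U y -> U (x `&` y)%O.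
  by move=> Ux Uy; rewrite -[(x `&` y)%O]complK; apply: UC; exact: UN.
have U0 : U \bot%O by exists 0%N.
apply: generated_min; last by move=> x Hx; exists 0%N.
split=> //; first by rewrite -compl0; exact: UC.
by move=> x y Ux Uy; rewrite -[(x `|` y)%O]complK complU; apply/UC/UI; exact: UC.
Qed.

Lemma countable_generated H : countable H -> countable (generated H).
Proof.
move=> Hc; pose H' := H `|` [set \bot%O].
have H'c : countable H' by apply: countableU => //; exact: countable1.
apply: (@sub_countable _ _ _ (\bigcup_n nand_iter H' n)).
  apply: subset_card_le; apply: subset_trans (generated_sub_nand_iter _); last by right.
  by apply: generated_mono; exact: subsetUl.
apply: bigcup_countable => // n _; elim: n => // n IH /=.
apply: countableU => //; apply: sub_countable (card_image_le _ _) _.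
exact: countableX.
Qed.

End Subalgebras.

(** * Images and preimages of subalgebras *)

Section Homomorphisms.
Variables (d e : Order.disp_t) (B : ctbDistrLatticeType d) (C : ctbDistrLatticeType e).
Variable (f : B -> C).
Hypothesis fhom : boolean_hom f.

Lemma subalgebra_image (S : set B) : subalgebra S -> subalgebra (f @` S).
Proof.
have [f0 f1 fI fU fC] := fhom; move=> [S0 S1 SI SU SC]; split.
- by exists \bot%O.
- by exists \top%O.
- by move=> _ _ [x Sx <-] [y Sy <-]; exists (x `&` y)%O => //; exact: SI.
- by move=> _ _ [x Sx <-] [y Sy <-]; exists (x `|` y)%O => //; exact: SU.
- by move=> _ [x Sx <-]; exists (~` x)%O => //; exact: SC.
Qed.

Lemma subalgebra_preimage (S : set C) : subalgebra S -> subalgebra (f @^-1` S).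
Proof.
have [f0 f1 fI fU fC] := fhom; move=> [S0 S1 SI SU SC].
split; rewrite /preimage /= ?f0 ?f1 // => *; rewrite ?fI ?fU ?fC;
  by [exact: SI|exact: SU|exact: SC].
Qed.

Lemma image_generated (H : set B) : f @` generated H = generated (f @` H).
Proof.
apply/seteqP; split; last first.
  apply: generated_min; first exact: subalgebra_image (generated_subalgebra _).
  by apply: image_subset; exact: sub_generated.
move=> _ [x Hx <-]; apply: (generated_min (subalgebra_preimage (generated_subalgebra _)) _ Hx).
by move=> y Hy; apply: sub_generated; exists y.
Qed.

End Homomorphisms.

(* An additive sigma-skeleton in the sense of Geschke. *)
Definition skeleton (d : Order.disp_t) (B : ctbDistrLatticeType d)
    (F : set (set B)) : Prop :=
  [/\ forall A, F A -> subalgebra A,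
      forall C, C `<=` F -> F (generated (\bigcup_(A in C) A)),
      forall X, countable X -> exists N, [/\ F N, countable N & X `<=` N]
    & forall A N, F A -> F N -> interpolates A N].

(** * The skeleton of a tightly sigma-filtered algebra *)

Section Steps.
Variables (d : Order.disp_t) (B : ctbDistrLatticeType d).
Variables (dI : Order.disp_t) (I : orderType dI) (S : I -> set B).
Hypothesis wfI : well_founded (fun i j : I => (i < j)%O).

Definition span (M : set I) : set B := generated (\bigcup_(i in M) S i).
Definition below (k : I) : set I := [set j | (j < k)%O].

Hypothesis subalgebraS : forall i, subalgebra (S i).
Hypothesis countableS : forall i, countable (S i).
Hypothesis interpS : forall i, interpolates (span (below i)) (S i).
Hypothesis spanT : span setT = setT.

Implicit Types (M N D : set I) (i j k : I).

Lemma subalgebra_span M : subalgebra (span M).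
Proof. exact: generated_subalgebra. Qed.

Lemma span_mono M N : M `<=` N -> span M `<=` span N.
Proof. by move=> MN; apply: generated_mono; exact: bigcup_subset. Qed.

Lemma sub_span M i : M i -> S i `<=` span M.
Proof. by move=> Mi; apply: subset_trans (@sub_generated _ _ _); exact: bigcup_sup. Qed.

Definition closed_steps M :=
  forall i, M i -> S i `&` span (below i) `<=` span (M `&` below i).

Lemma closed_steps_bigcup (T : Type) (D : set T) (M : T -> set I) :
  (forall t, D t -> closed_steps (M t)) -> closed_steps (\bigcup_(t in D) M t).
Proof.
move=> Mc i [t Dt Mti]; apply: subset_trans (Mc _ Dt _ Mti) _.
by apply: span_mono; apply: setSI; exact: bigcup_sup.
Qed.

Lemma closed_stepsU M N : closed_steps M -> closed_steps N -> closed_steps (M `|` N).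
Proof.
move=> Mc Nc i [/Mc|/Nc] Mi; apply: subset_trans Mi _; apply: span_mono; apply: setSI.
  exact: subsetUl.
exact: subsetUr.
Qed.

(** The spans of the empty set and of the initial pieces of [M] form a chain, so their union is a
    subalgebra, and it contains every [S i] with [i] in [M]. This makes induction on levels
    possible. *)
Lemma span_support M x : span M x ->
  span set0 x \/ exists2 k, M k & span (M `&` [set j | (j <= k)%O]) x.
Proof.
pose Q N := N = set0 \/ exists2 k, M k & N = M `&` [set j | (j <= k)%O].
have Qtot : total_on [set span N | N in Q] subset.
  move=> _ _ [N1 Q1 <-] [N2 Q2 <-].
  suff [/span_mono|/span_mono] : N1 `<=` N2 \/ N2 `<=` N1; [by left|by right|].
  case: Q1 => [->|[k1 _ ->]]; first by left.
  case: Q2 => [->|[k2 _ ->]]; first by right.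
  by have [k12|/ltW k21] := leP k1 k2; [left|right]; apply: setIS => j /= /le_trans; apply.
have Usub : subalgebra (\bigcup_(X in [set span N | N in Q]) X).
  apply: subalgebra_chain => //; first by exists (span set0), set0 => //; left.
  by move=> _ [N _ <-]; exact: subalgebra_span.
move=> Mx; have [] := generated_min Usub _ Mx.
  move=> y [i Mi Siy]; exists (span (M `&` [set j | (j <= i)%O])).
    by exists (M `&` [set j | (j <= i)%O]) => //; right; exists i.
  by apply: sub_span Siy; split=> //=.
by move=> _ [N [->|[k Mk ->]] <-]; [left|right; exists k].
Qed.

Section Interpolation.
Variables (M N : set I).
Hypotheses (Mc : closed_steps M) (Nc : closed_steps N).

Let between (a b : B) := exists r, [/\ span M r, span N r, (a <= r)%O & (r <= b)%O].
Let upto (k : I) := [set j | (j <= k)%O].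
Let at_level k := forall a b, span (M `&` upto k) a -> span (N `&` upto k) b ->
  (a <= b)%O -> between a b.

(** The larger of the levels at which [a] and [b] appear serves for both; an element of [span set0]
    is its own interpolant. *)
Lemma between_levels D : (forall k, D k -> at_level k) ->
  forall a b, span (M `&` D) a -> span (N `&` D) b -> (a <= b)%O -> between a b.
Proof.
move=> IH a b Ma Nb ab.
have [a0|[k1 [Mk1 Dk1] a1]] := span_support Ma.
  exists a; split=> //; [move: a0|move: a0]; exact: span_mono.
have [b0|[k2 [Nk2 Dk2] b2]] := span_support Nb.
  exists b; split=> //; [move: b0|move: b0]; exact: span_mono.
have [k12|/ltW k21] := leP k1 k2.
- apply: (IH k2) => //; [move: a1|move: b2]; apply: span_mono.
    by move=> j [[Mj _] jk]; split=> //; exact: le_trans jk k12.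
  by move=> j [[Mj _] jk].
- apply: (IH k1) => //; [move: a1|move: b2]; apply: span_mono.
    by move=> j [[Mj _] jk].
  by move=> j [[Mj _] jk]; split=> //; exact: le_trans jk k21.
Qed.

Lemma span_upto_in (M' : set I) k : M' k ->
  span (M' `&` upto k) `<=` generated (span (M' `&` below k) `|` S k).
Proof.
move=> Mk; apply: generated_min; first exact: generated_subalgebra.
move=> x [j [Mj]]; rewrite /upto /= le_eqVlt => /orP[/eqP-> Sx|jk Sx].
  by apply: sub_generated; right.
by apply: sub_generated; left; apply: sub_span Sx.
Qed.

Lemma span_upto_notin (M' : set I) k : ~ M' k ->
  span (M' `&` upto k) `<=` span (M' `&` below k).
Proof.
move=> Mk; apply: span_mono => j [Mj]; rewrite /upto /= le_eqVlt => /orP[/eqP jk|//].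
by case: Mk; rewrite -jk.
Qed.

Lemma between_join a a' b : between a b -> between a' b -> between (a `|` a')%O b.
Proof.
move=> [r [Mr Nr ar rb]] [r' [Mr' Nr' ar' rb']]; exists (r `|` r')%O; split; try by ba.
  by have [_ _ _ + _] := subalgebra_span M; exact.
by have [_ _ _ + _] := subalgebra_span N; exact.
Qed.

Lemma between_meet a b b' : between a b -> between a b' -> between a (b `&` b')%O.
Proof.
move=> [r [Mr Nr ar rb]] [r' [Mr' Nr' ar' rb']]; exists (r `&` r')%O; split; try by ba.
  by have [_ _ + _ _] := subalgebra_span M; exact.
by have [_ _ + _ _] := subalgebra_span N; exact.
Qed.

(** If [k] is in both sets, normal forms reduce the claim to a meet of [a] and [s] below a join of
    [b] and [t], with [s], [t] in [S k] and [a], [b] from earlier steps. Then [a] minus [b] lies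
    below the join of [t] and the complement of [s]. The step hypothesis gives [r] in [S k] between
    them, closedness puts [r] into the earlier part of the span, and the induction hypothesis
    interpolates between [a] and the join of [b] and [r]. *)
Lemma at_levels k : at_level k.
Proof.
elim: (wfI k) => {}k _ IHk.
have IH a b : span (M `&` below k) a -> span (N `&` below k) b -> (a <= b)%O -> between a b.
  exact: between_levels.
have sM P : span (P `&` below k) `<=` span P by apply: span_mono; exact: subIsetl.
have sB P : span (P `&` below k) `<=` span (below k) by apply: span_mono; exact: subIsetr.
have [_ _ MI MU MC] := subalgebra_span M; have [_ _ NI NU NC] := subalgebra_span N.
have [_ _ MkI MkU MkC] := subalgebra_span (M `&` below k).
have [_ _ NkI NkU NkC] := subalgebra_span (N `&` below k).
have [_ _ BI BU BC] := subalgebra_span (below k).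
have [_ _ SI SU SC] := subalgebraS k.
have [Nk|nNk] := pselect (N k); have [Mk|nMk] := pselect (M k).
- move=> a b /(span_upto_in Mk) Ma /(span_upto_in Nk) Nb; move: a Ma b Nb.
  apply: (generated_join_ind (subalgebra_span _) (subalgebraS k)); last first.
    move=> a a' IHa IHa' b Nb ab.
    by apply: between_join; [apply: IHa|apply: IHa'] => //; ba.
  move=> a s Ma Ss; apply: (generated_meet_ind (subalgebra_span _) (subalgebraS k)); last first.
    move=> b b' IHb IHb' ab.
    by apply: between_meet; [apply: IHb|apply: IHb']; ba.
  move=> b t Nb St ab.
  have [|||r [Br Sr ar rt]] := @interpS k (a `&` ~` b)%O (t `|` ~` s)%O.
  + by apply: BI; [exact: sB Ma|apply: BC; exact: sB Nb].
  + by apply: SU => //; exact: SC.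
  + by ba.
  have Nr : span (N `&` below k) r by apply: (Nc Nk).
  have [||w [Mw Nw aw wb]] := IH a (b `|` r)%O Ma; [exact: NkU|by ba|].
  (* Meeting with [s] brings [r] below [t]; [s] is in both spans because [k] is in both sets. *)
  exists (w `&` s)%O; split; try by ba.
    by apply: MI => //; exact: sub_span Ss.
  by apply: NI => //; exact: sub_span Ss.
- move=> a b /(span_upto_notin nMk) Ma /(span_upto_in Nk); move: b.
  apply: (generated_meet_ind (subalgebra_span _) (subalgebraS k)); last first.
    move=> b b' IHb IHb' ab.
    by apply: between_meet; [apply: IHb|apply: IHb']; ba.
  move=> b t Nb St ab.
  have [|||r [Br Sr ar rt]] := @interpS k (a `&` ~` b)%O t.
  + by apply: BI; [exact: sB Ma|apply: BC; exact: sB Nb].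
  + by [].
  + by ba.
  have Nr : span (N `&` below k) r by apply: (Nc Nk).
  have [||w [Mw Nw aw wb]] := IH a (b `|` r)%O Ma; [exact: NkU|by ba|].
  by exists w; split=> //; ba.
- move=> a b + /(span_upto_notin nNk) Nb; move=> /(span_upto_in Mk); move: a.
  apply: (generated_join_ind (subalgebra_span _) (subalgebraS k)); last first.
    move=> a a' IHa IHa' ab.
    by apply: between_join; [apply: IHa|apply: IHa'] => //; ba.
  move=> a s Ma Ss ab.
  have [|||r [Br Sr ar rt]] := @interpS k (a `&` ~` b)%O (~` s)%O.
  + by apply: BI; [exact: sB Ma|apply: BC; exact: sB Nb].
  + exact: SC.
  + by ba.
  (* Here only [M] contains [k], so [r] has to be removed from [a] instead of being added to [b]. *)
  have Mr : span (M `&` below k) r by apply: (Mc Mk).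
  have [||w [Mw Nw aw wb]] := IH (a `&` ~` r)%O b _ Nb; [|by ba|].
    by apply: MkI => //; exact: MkC.
  by exists w; split=> //; ba.
- by move=> a b /(span_upto_notin nMk) Ma /(span_upto_notin nNk) Nb; exact: IH.
Qed.

Lemma interpolates_span : interpolates (span M) (span N).
Proof.
move=> a b Ma Nb; apply: (@between_levels setT) => //; rewrite ?setIT //.
by move=> k _; exact: at_levels.
Qed.

End Interpolation.

Definition countably_supported D x :=
  exists N, [/\ closed_steps N, countable N, N `<=` D & span N x].

Lemma span_supported D x :
  (forall j y, D j -> S j y -> countably_supported D y) ->
  span D x -> countably_supported D x.
Proof.
move=> IH; apply: generated_min; last by move=> y [j Dj Sy]; exact: (IH j).
have join2 x1 x2 : countably_supported D x1 -> countably_supported D x2 ->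
    exists N, [/\ closed_steps N, countable N, N `<=` D & span N x1 /\ span N x2].
  move=> [N1 [c1 n1 s1 x1N]] [N2 [c2 n2 s2 x2N]]; exists (N1 `|` N2); split.
  - exact: closed_stepsU.
  - exact: countableU.
  - by rewrite subUset.
  - by split; [move: x1N|move: x2N]; apply: span_mono; [exact: subsetUl|exact: subsetUr].
have c0 : countably_supported D \bot%O.
  by exists set0; split=> //; have [] := subalgebra_span set0.
split=> //.
- by exists set0; split=> //; have [] := subalgebra_span set0.
- move=> x1 x2 s1 s2; have [N [cN Nc Nk [x1N x2N]]] := join2 _ _ s1 s2.
  by exists N; split=> //; have [_ _ + _ _] := subalgebra_span N; exact.
- move=> x1 x2 s1 s2; have [N [cN Nc Nk [x1N x2N]]] := join2 _ _ s1 s2.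
  by exists N; split=> //; have [_ _ _ + _] := subalgebra_span N; exact.
- move=> x1 [N [cN Nc Nk x1N]].
  by exists N; split=> //; have [_ _ _ _ +] := subalgebra_span N; exact.
Qed.

(** By induction, each of the countably many elements of [S i] spanned by earlier steps has a
    countable closed support below [i]; the union of these supports, with [i] added, is closed. *)
Lemma step_supported i x : S i x ->
  exists N, [/\ closed_steps N, countable N, N `<=` [set j | (j <= i)%O] & span N x].
Proof.
elim: (wfI i) x => {}i _ IH x Sx.
have sup y : span (below i) y -> countably_supported (below i) y.
  apply: span_supported => j z ji Sz; have [N [cN Nc Nj zN]] := IH _ ji _ Sz.
  by exists N; split=> // l /Nj /= lj; exact: le_lt_trans ji.
pose supp y : set I := if pselect (countably_supported (below i) y) is left H then projT1 (cid H) else set0.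
have suppP y : span (below i) y -> [/\ closed_steps (supp y), countable (supp y), supp y `<=` below i & span (supp y) y].
  by move=> /sup sy; rewrite /supp; case: pselect => // H; case: cid.
pose N0 := \bigcup_(y in S i `&` span (below i)) supp y.
have N0i : N0 `<=` below i by apply: bigcup_sub => y [_ /suppP[]].
exists (N0 `|` [set i]); split.
- move=> j [N0j|->].
    have /(_ _ N0j) Hj : closed_steps N0.
      by apply: closed_steps_bigcup => y [_ /suppP[]].
    by apply: subset_trans Hj _; apply: span_mono; apply: setSI; exact: subsetUl.
  move=> y [Sy yi]; have [_ _ si ys] := suppP _ yi.
  move: ys; apply: span_mono => l ly; split; last exact: si.
  by left; exists y.
- apply: countableU; last exact: countable1.
  apply: bigcup_countable => [|y [_ /suppP[]] //].
  by apply: sub_countable (countableS i); apply: subset_card_le; exact: subIsetl.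
- by move=> j [/N0i/ltW|->] /=.
- by apply: sub_span Sx; right.
Qed.

Lemma skeleton_steps : skeleton [set span M | M in closed_steps].
Proof.
split.
- by move=> _ [M _ <-]; exact: subalgebra_span.
(* All closed sets whose span is in [C] are taken together, which avoids choosing one for each
   member. *)
- move=> C CF; exists (\bigcup_(M in [set M | closed_steps M /\ C (span M)]) M).
    by apply: closed_steps_bigcup => M [].
  apply/seteqP; split; apply: generated_min; try exact: generated_subalgebra.
    move=> x [i [M [Mc CM] Mi] Sx]; apply: sub_generated; exists (span M) => //.
    exact: sub_span Sx.
  move=> x [A CA Ax]; have [M Mc AM] := CF _ CA.
  move: Ax; rewrite -AM; apply: span_mono; apply: bigcup_sup; split=> //.
  by rewrite AM.
- move=> X Xc.
  have sup x : countably_supported setT x.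
    apply: span_supported; last by rewrite spanT.
    by move=> j y _ Sy; have [N [cN Nc _ yN]] := step_supported Sy; exists N.
  have [N HN] := choice sup; exists (span (\bigcup_(x in X) N x)); split.
  + exists (\bigcup_(x in X) N x) => //; apply: closed_steps_bigcup => x _.
    by have [] := HN x.
  + apply: countable_generated; apply: bigcup_countable => //.
    by apply: bigcup_countable => // x _; have [] := HN x.
  + move=> x Xx; have [_ _ _ +] := HN x; apply: span_mono; exact: bigcup_sup.
- move=> _ _ [M Mc <-] [N Nc <-]; exact: interpolates_span.
Qed.

End Steps.

(** * Well-orders *)

Section WellOrders.
Variables (T : Type) (R : rel T).
Hypothesis woR : wochoice.well_order R.

Lemma wo_min (P : set T) : P !=set0 ->
  exists2 z, P z & forall y, P y -> R z y.
Proof.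
move=> [x Px]; have [|z [[Pz zmin] _]] := woR (A := fun x => `[< P x >]).
  by exists x; apply/asboolP.
exists z; first exact/asboolP.
by move=> y Py; apply: zmin; apply/asboolP.
Qed.

Lemma wo_refl x : R x x.
Proof. by have [|z -> zx] := @wo_min [set x]; [exists x|exact: zx]. Qed.

Lemma wo_total x y : R x y \/ R y x.
Proof.
have [|z [->|->] zmin] := @wo_min [set x; y]; first by exists x; left.
  by left; apply: zmin; right.
by right; apply: zmin; left.
Qed.

Lemma wo_anti x y : R x y -> R y x -> x = y.
Proof.
move=> xy yx; pose A : {pred T} := fun z => `[< z = x \/ z = y >].
have [|z [_ zu]] := woR (A := A); first by exists x; apply/asboolP; left.
rewrite -(zu x) ?(zu y) //; split; try by apply/asboolP; (left + right).
  by move=> u /asboolP[]->; [|exact: wo_refl].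
by move=> u /asboolP[]->; [exact: wo_refl|].
Qed.

Lemma wo_wf : well_founded (fun x y => R x y /\ x <> y).
Proof.
move=> x; apply: contrapT => nx.
have [|z nz zmin] := @wo_min [set y | ~ Acc (fun x y => R x y /\ x <> y) y].
  by exists x.
apply: nz; constructor=> y [yz nyz]; apply: contrapT => ny.
by apply: nyz; apply: wo_anti => //; exact: zmin.
Qed.

End WellOrders.

(** The steps are the countable algebras of the successive push-outs. Since [F i] is the span of the
    steps below [i], the push-out clause is the interpolation hypothesis on steps. *)
Lemma tightly_sigma_filtered_skeleton (d : Order.disp_t) (B : ctbDistrLatticeType d) :
  tightly_sigma_filtered B -> exists F, @skeleton d B F.
Proof.
move=> [dI [I [F [woI [Fsub Fmono [F0 F1] Fsucc Flim]]]]].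
have wfI : well_founded (fun i j : I => (i < j)%O).
  move=> i; elim: (wo_wf woI i) => {}i _ IH; constructor=> j ji; apply: IH.
  by split; [exact: ltW|move=> jeq; rewrite jeq ltxx in ji].
have succ_ex (i j : I) : (i < j)%O -> exists k, is_succ i k /\ (k <= j)%O.
  move=> ij; have [|k ik kmin] := wo_min woI (P := [set k | (i < k)%O]).
    by exists j.
  by exists k; split; [split|exact: kmin].
have gen (i : I) : exists S : set B, [/\ subalgebra S, countable S, interpolates (F i) S
    & forall j, is_succ i j -> S `<=` F j /\ F j = generated (S `|` F i)].
  (* Only [\top] has no successor; its step is the two-element algebra, which interpolates
     trivially. *)
  have [[k ik]|nk] := pselect (exists k, is_succ i k); last first.
    have B0 : @subalgebra d B [set \bot%O; \top%O].
      by rewrite -F0; exact: Fsub.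
    exists [set \bot%O; \top%O]; split=> //.
    - by apply: countableU; exact: countable1.
    - move=> a s Fa + as_; have [Fi0 Fi1 _ _ _] := Fsub i.
      by case=> se; exists s; split=> //; rewrite se //; [left|right].
    - by move=> j ij; case: nk; exists j.
  have [S [Sc [[_ SS _] [SF _] Fk FI]]] := Fsucc _ _ ik.
  exists S; split=> // j ij; suff -> : j = k by [].
  by apply: le_anti; rewrite (proj2 ij) ?(proj1 ik) // (proj2 ik) ?(proj1 ij).
have [S SP] := choice gen.
have FE i : F i = span S (below i).
  elim: (wfI i) => {}i _ IH; apply/seteqP; split.
    have [->|i0] := eqVneq i \bot%O.
      rewrite F0 => x [->|->]; by have [] := subalgebra_span S (below (\bot : I)%O).
    have [[k ki]|nk] := pselect (exists k, is_succ k i).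
      have [_ _ _ /(_ _ ki) [_ ->]] := SP k.
      apply: generated_min; first exact: subalgebra_span.
      rewrite subUset; split; first by apply: sub_span; exact: (proj1 ki).
      rewrite IH ?(proj1 ki) //; apply: span_mono => j jk.
      exact: lt_trans jk (proj1 ki).
    rewrite Flim; last by split; [exact/eqP|move=> k ki; apply: nk; exists k].
    apply: bigcup_sub => j ji; rewrite IH //; apply: span_mono => k kj.
    exact: lt_trans kj ji.
  apply: generated_min => //; apply: bigcup_sub => j ji.
  have [k [jk ki]] := succ_ex _ _ ji; have [_ _ _ /(_ _ jk) [SF _]] := SP j.
  apply: subset_trans SF _; move: ki; rewrite le_eqVlt => /orP[/eqP->//|].
  exact: Fmono.
exists [set span S M | M in closed_steps S]; apply: skeleton_steps => //.
- by move=> i; have [] := SP i.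
- by move=> i; have [] := SP i.
- by move=> i; rewrite -FE; have [] := SP i.
- apply/seteqP; split=> // x _; apply: (@span_mono _ _ _ _ S (below \top%O)) => //.
  by rewrite -FE F1.
Qed.

(** * Sets of cardinality less than the continuum *)

Section Small.

(* For subsets of a set of cardinality c this means having cardinality < c; the
   negative form avoids comparability of cardinals. *)
Definition small (U : Type) (X : set U) : Prop := ~ ([set: set nat] #<= X).

Lemma small_le (U V : Type) (X : set U) (Y : set V) : X #<= Y -> small Y -> small X.
Proof. by move=> XY Ys Xs; apply: Ys; exact: card_le_trans XY. Qed.

Lemma small_sub (U : Type) (X Y : set U) : X `<=` Y -> small Y -> small X.
Proof. by move=> /subset_card_le; exact: small_le. Qed.

Lemma small_image (U V : Type) (f : U -> V) (X : set U) : small X -> small (f @` X).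
Proof. exact: small_le (card_image_le _ _). Qed.

Lemma continuum_injection (U : Type) (X : set U) : [set: set nat] #<= X ->
  exists2 h : set nat -> U, injective h & forall a, X (h a).
Proof.
move=> /pcard_surjP[g gX].
have /choice[h hP] a : exists y, X y /\ g y = a.
  by have [y Xy ya] := gX a Logic.I; exists y.
exists h; last by move=> a; case: (hP a).
by apply: (can_inj (g := g)) => a; case: (hP a).
Qed.

Lemma small_countable (U : Type) (X : set U) : countable X -> small X.
Proof.
move=> Xc Xs; have : [set: set nat] #<= [set: nat] by exact: card_le_trans Xs Xc.
(* Cantor's diagonal set for the injection [f]. *)
move=> /continuum_injection[f fI _]; pose D := [set n | exists2 A : set nat, f A = n & ~ A n].
have : ~ D (f D).
  by move=> DD; have [A fA] := DD; move: (fA) => /fI AD; rewrite AD.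
by move=> nDD; apply: (nDD); exists D.
Qed.

(** Start from any well-order. If a proper initial segment has size continuum, take the least [x]
    with such a segment, inject [set nat] into it and pull the order back; minimality of [x] keeps
    the new segments small. *)
Lemma initial_well_order_exists : exists R : rel (set nat), initial_well_order R.
Proof.
have [R woR] := wochoice.well_ordering_principle (set nat : eqType).
pose seg x := [set y | R y x /\ y <> x].
have [Rsm|] := pselect (forall x, ~ ([set: set nat] #<= seg x)).
  exists R; split=> // x; split; first exact: card_leT.
  by apply/negP => /card_eqPle[_ xs]; exact: (Rsm x).
move=> /existsNP[x0 /contrapT x0b].
have [|x /= xb xmin] := wo_min woR (P := [set x | [set: set nat] #<= seg x]).
  by exists x0.
have [h hI hx] := continuum_injection xb.
exists (fun a b => R (h a) (h b)); split.
  move=> A [a Aa].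
  have [|_ [b Ab <-] bmin] := wo_min woR (P := h @` [set b | b \in A]).
    by exists (h a), a.
  exists b; split.
    by split=> // c Ac; apply: bmin; exists c.
  move=> c [Ac cmin]; apply: hI; apply: (wo_anti woR).
    by apply: bmin; exists c.
  exact: cmin.
move=> a; split; first exact: card_leT.
apply/negP => /card_eqPle[_ ab]; have [xa nxa] := hx a.
apply: nxa; apply: (wo_anti woR) => //; apply: xmin => /=.
set P := [set y | _] in ab; apply: (card_le_trans ab).
have /card_eqPle[_ Ph] : h @` P #= P by apply: inj_card_eq => y z _ _; exact: hI.
apply: (card_le_trans Ph); apply: subset_card_le => _ [y [ya nya] <-].
by split=> // /hI.
Qed.

Section Regular.
Hypothesis c_regular : regular_cardinal (set nat).

(** Regularity enters here. Were the union not small, map it onto [set nat] by [g]: the image of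
    each small [X j] is not cofinal, so it has a strict upper bound [b j], and these bounds would be
    cofinal although [D] is small. *)
Lemma small_bigcup (J U : Type) (D : set J) (X : J -> set U) : small D ->
  (forall j, D j -> small (X j)) -> small (\bigcup_(j in D) X j).
Proof.
move=> Ds Xs /pcard_surjP[g gX].
have [R Rinit] := initial_well_order_exists; have [woR _] := Rinit.
have [_ reg] := c_regular.
have bnd j : exists b, D j -> forall y, X j y -> ~ R b (g y).
  have [Dj|nDj] := pselect (D j); last by exists set0.
  apply: contrapT => nb; apply: (small_image (f := g) (Xs _ Dj)).
  have /card_eqPle[] // : g @` X j #= [set: set nat].
  apply: (reg R) => // b; apply: contrapT => nb'; apply: nb; exists b => _ y Xy Rb.
  by apply: nb'; exists (g y) => //; exists y.
have [b bP] := choice bnd; apply: (small_image (f := b) Ds).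
have /card_eqPle[] // : b @` D #= [set: set nat].
apply: (reg R) => // x; have [y [j Dj Xy] <-] := gX x Logic.I.
exists (b j); first by exists j.
by have [/(bP _ Dj _ Xy)|] := wo_total woR (b j) (g y).
Qed.

Lemma smallU (U : Type) (X Y : set U) : small X -> small Y -> small (X `|` Y).
Proof.
move=> Xs Ys; rewrite -bigcup2E; apply: small_bigcup => [|[|[|i]] _] //=.
  exact: small_countable.
exact: small_countable.
Qed.

Lemma small_generated (d : Order.disp_t) (B : ctbDistrLatticeType d) (H : set B) :
  small H -> small (generated H).
Proof.
move=> Hs; pose H' := H `|` [set \bot%O].
have Hs' : small H' by apply: smallU => //; exact: small_countable.
apply: (@small_sub _ _ (\bigcup_n nand_iter H' n)).
  apply: subset_trans (generated_sub_nand_iter _); last by right.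
  by apply: generated_mono; exact: subsetUl.
apply: small_bigcup => [|n _]; first exact: small_countable.
elim: n => // n IH /=; apply: smallU => //; apply: small_image.
have -> : nand_iter H' n `*` nand_iter H' n =
    \bigcup_(x in nand_iter H' n) (pair x @` nand_iter H' n).
  apply/seteqP; split=> [[x y] [/= Hx Hy]|_ [x Hx [y Hy <-]]] //.
  by exists x => //; exists y.
by apply: small_bigcup => // x _; exact: small_image.
Qed.

End Regular.
End Small.

(** * Subalgebras as Boolean algebras in their own right *)

Section SubalgebraType.
Variables (d : Order.disp_t) (B : ctbDistrLatticeType d) (S : set B).
Hypothesis SS : subalgebra S.

(* [H] is a parameter so that the algebra structure can be attached to the type. *)
Record subalgebra_type (H : subalgebra S) := Subalgebra { sub_val : B; sub_valP : S sub_val }.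
Local Notation T := (subalgebra_type SS).

Lemma sub_val_inj : injective (@sub_val SS).
Proof. by move=> [x Sx] [y Sy] /= xy; move: Sx Sy; rewrite xy => Sx Sy; congr Subalgebra; exact: Prop_irrelevance. Qed.

HB.instance Definition _ := gen_eqMixin T.
HB.instance Definition _ := gen_choiceMixin T.

Definition sub_meet (x y : T) : T :=
  Subalgebra SS (let: And5 _ _ SI _ _ := SS in SI _ _ (sub_valP x) (sub_valP y)).
Definition sub_join (x y : T) : T :=
  Subalgebra SS (let: And5 _ _ _ SU _ := SS in SU _ _ (sub_valP x) (sub_valP y)).
Definition sub_compl (x : T) : T :=
  Subalgebra SS (let: And5 _ _ _ _ SC := SS in SC _ (sub_valP x)).
Definition sub_bot : T := Subalgebra SS (let: And5 S0 _ _ _ _ := SS in S0).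
Definition sub_top : T := Subalgebra SS (let: And5 _ S1 _ _ _ := SS in S1).
Definition sub_le (x y : T) : bool := (sub_val x <= sub_val y)%O.
Definition sub_lt (x y : T) : bool := (y != x) && sub_le x y.

Lemma sub_le_def x y : sub_le x y = (sub_meet x y == x).
Proof.
rewrite /sub_le leEmeet; apply/eqP/eqP => [xy|/(congr1 (@sub_val SS))//].
exact: sub_val_inj.
Qed.

Lemma sub_lt_def x y : sub_lt x y = (y != x) && sub_le x y.
Proof. by []. Qed.

Lemma sub_meetC : commutative sub_meet.
Proof. by move=> x y; apply: sub_val_inj; exact: meetC. Qed.
Lemma sub_joinC : commutative sub_join.
Proof. by move=> x y; apply: sub_val_inj; exact: joinC. Qed.
Lemma sub_meetA : associative sub_meet.
Proof. by move=> x y z; apply: sub_val_inj; exact: meetA. Qed.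
Lemma sub_joinA : associative sub_join.
Proof. by move=> x y z; apply: sub_val_inj; exact: joinA. Qed.
Lemma sub_joinKI y x : sub_meet x (sub_join x y) = x.
Proof. by apply: sub_val_inj; exact: joinKI. Qed.
Lemma sub_meetKU y x : sub_join x (sub_meet x y) = x.
Proof. by apply: sub_val_inj; exact: meetKU. Qed.
Lemma sub_meetUl : left_distributive sub_meet sub_join.
Proof. by move=> x y z; apply: sub_val_inj; exact: meetUl. Qed.
Lemma sub_meetxx : idempotent_op sub_meet.
Proof. by move=> x; apply: sub_val_inj; exact: meetxx. Qed.

HB.instance Definition _ := @Order.isMeetJoinDistrLattice.Build d T
  sub_le sub_lt sub_meet sub_join sub_le_def sub_lt_def
  sub_meetC sub_joinC sub_meetA sub_joinA sub_joinKI sub_meetKU sub_meetUl sub_meetxx.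

Lemma sub_le0x (x : T) : (sub_bot <= x)%O.
Proof. exact: le0x. Qed.
Lemma sub_lex1 (x : T) : (x <= sub_top)%O.
Proof. exact: lex1. Qed.

HB.instance Definition _ := @Order.hasBottom.Build d T sub_bot sub_le0x.
HB.instance Definition _ := @Order.hasTop.Build d T sub_top sub_lex1.

Lemma sub_joinxC (x : T) : (x `|` sub_compl x)%O = \top%O.
Proof. by apply: sub_val_inj; exact: joinxC. Qed.
Lemma sub_meetxC (x : T) : (x `&` sub_compl x)%O = \bot%O.
Proof. by apply: sub_val_inj; exact: meetxC. Qed.

HB.instance Definition _ :=
  @Order.TBDistrLattice_hasComplement.Build d T sub_compl sub_joinxC sub_meetxC.

Lemma card_subalgebra_type : [set: T] #= S.
Proof.
have -> : S = @sub_val SS @` [set: T].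
  by apply/seteqP; split=> [x Sx|_ [x _ <-]]; [exists (Subalgebra SS Sx)|exact: sub_valP].
by rewrite card_eq_sym; apply: inj_card_eq => x y _ _; exact: sub_val_inj.
Qed.

End SubalgebraType.

(** * Neighborhoods in the Stone space and P-points *)

Section StonePoints.
Variables (d : Order.disp_t) (B : ctbDistrLatticeType d).

Lemma nbhs_stone (p : Stone B) (U : set (Stone B)) :
  nbhs p U -> exists2 a, stone_set p a & stone_clopen a `<=` U.
Proof.
rewrite nbhsE => -[V [[D DS VE] Vp] VU]; move: Vp; rewrite -VE => -[W DW Wp].
have [a _ aW] := DS _ DW; exists a; first by rewrite -aW in Wp.
by move=> r ra; apply: VU; rewrite -VE; exists W => //; rewrite /= -aW.
Qed.

Lemma open_stone_clopen (a : B) : open (stone_clopen a).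
Proof.
by exists [set stone_clopen a]; [move=> _ ->; exists a|rewrite bigcup_set1].
Qed.

(** The clopen sets of the members of [D] are countably many neighborhoods of [p], so their
    intersection contains a basic clopen neighborhood, that of [c]. *)
Lemma P_point_lower_bound (p : Stone B) (D : set B) : P_point p -> countable D ->
  D `<=` stone_set p -> exists2 c, stone_set p c & forall a, D a -> (c <= a)%O.
Proof.
move=> hp /pfcard_geP[->|/surjfunPex[f Df]] Dp.
  by exists \top%O => //; case: (stone_setP p) => -[].
have [n|c pc cD] := @nbhs_stone p _ (hp (fun n => stone_clopen (f n)) _).
  apply: open_nbhs_nbhs; split; first exact: open_stone_clopen.
  by apply: Dp; rewrite Df; exists n.
exists c => // a; rewrite Df => -[n _ <-].
by apply: le_ev => r; apply/implyP => /evP rc; apply/evP; exact: (cD r rc).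
Qed.

End StonePoints.

Lemma fst_hom (d e : Order.disp_t) (B : ctbDistrLatticeType d) (C : ctbDistrLatticeType e) :
  boolean_hom (fst : B *p C -> B).
Proof. by split. Qed.

Lemma snd_hom (d e : Order.disp_t) (B : ctbDistrLatticeType d) (C : ctbDistrLatticeType e) :
  boolean_hom (snd : B *p C -> C).
Proof. by split. Qed.

Lemma swap_hom (d e : Order.disp_t) (B : ctbDistrLatticeType d) (C : ctbDistrLatticeType e) :
  boolean_hom ((fun z => (z.2, z.1)) : B *p C -> C *p B).
Proof. by split. Qed.

(** * Back and forth *)

Section BackAndForth.
Variables (d : Order.disp_t) (BB : ctbDistrLatticeType d).
Hypothesis c_regular : regular_cardinal (set nat).
Hypothesis card_BB : [set: BB] #= [set: set nat].
Hypothesis ext_BB : forall (dA dB : Order.disp_t) (A : ctbDistrLatticeType dA)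
      (B : ctbDistrLatticeType dB) (u : A -> BB) (v : A -> B),
    card_lt [set: A] [set: set nat] -> embedding u -> posex_embedding v ->
    exists2 u' : B -> BB, embedding u' & forall a, u' (v a) = u a.
Implicit Types (p q : Stone BB) (G K : set (BB *p BB)) (S X : set BB).

(* Partial isomorphisms are represented by their graphs, so that extending one
   amounts to generating a larger subalgebra of the square. *)
Definition partial_iso p q G :=
  [/\ subalgebra G, forall z, G z -> (z.1 == \bot%O) = (z.2 == \bot%O)
    & forall z, G z -> ev p z.1 = ev q z.2].

Definition dom G : set BB := fst @` G.
Definition rng G : set BB := snd @` G.

Lemma partial_iso_le p q G z t : partial_iso p q G -> G z -> G t ->
  (z.1 <= t.1)%O = (z.2 <= t.2)%O.
Proof.
move=> [[_ _ GI _ GC] G0 _] Gz Gt.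
have := G0 _ (GI _ _ Gz (GC _ Gt)).
by rewrite /= !disj_leC !complK.
Qed.

Lemma partial_iso_inj p q G z t : partial_iso p q G -> G z -> G t ->
  z.1 = t.1 -> z.2 = t.2.
Proof.
move=> PG Gz Gt zt; apply: le_anti.
by rewrite -(partial_iso_le PG Gz Gt) -(partial_iso_le PG Gt Gz) zt lexx.
Qed.

(* The extension property is applied to the diagonal [C -> C * C] above
   [C = <dom G, S>]: the image [x] of [(1, 0)] is then independent of that of [C]. *)
Lemma extend_partial_iso p q G S : partial_iso p q G -> small G ->
  subalgebra S -> countable S -> interpolates (dom G) S ->
  let C := generated (dom G `|` S) in
  exists (u : BB -> BB) (x : BB),
  [/\ u \bot%O = \bot%O /\ u \top%O = \top%O,
      forall y z, C y -> C z -> u (y `&` z)%O = (u y `&` u z)%O,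
      forall y, C y -> u (~` y)%O = (~` u y)%O,
      forall z, G z -> u z.1 = z.2
    & (forall y, C y -> u y = \bot%O -> y = \bot%O) /\
      (forall y, C y -> (u y <= x)%O || (u y <= ~` x)%O -> y = \bot%O)].
Proof.
move=> PG Gsm SS Sc GS C; have [GG G0 _] := PG.
have CC : subalgebra C := generated_subalgebra _.
pose A : ctbDistrLatticeType _ := subalgebra_type GG.
pose CT : ctbDistrLatticeType _ := subalgebra_type CC.
have domC z : G z -> C z.1 by move=> Gz; apply: sub_generated; left; exists z.
pose k (g : A) : CT := Subalgebra CC (domC _ (sub_valP g)).
pose v (g : A) : CT *p CT := (k g, k g).
pose u0 (g : A) : BB := (sub_val g).2.
have u0E : embedding u0.
  split; first by split.
  move=> g h gh; apply: sub_val_inj; rewrite [sub_val g]surjective_pairing [sub_val h]surjective_pairing.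
  congr (_, _) => //; apply: le_anti.
  rewrite (partial_iso_le PG (sub_valP g) (sub_valP h)) (partial_iso_le PG (sub_valP h) (sub_valP g)).
  by move: gh; rewrite /u0 => ->; rewrite lexx.
have khom : boolean_hom k by split=> *; exact: (@sub_val_inj _ _ _ CC).
have vhom : boolean_hom v.
  by case: khom => k0 k1 kI kU kC; split; rewrite /v ?k0 ?k1 // => *; rewrite ?kI ?kU ?kC.
have vinj : injective v.
  move=> g h [gh1 _]; apply: sub_val_inj; rewrite [sub_val g]surjective_pairing [sub_val h]surjective_pairing.
  by rewrite gh1 (partial_iso_inj PG (sub_valP g) (sub_valP h) gh1).
have vposex : posex_embedding v.
  have SC : S `<=` C by move=> y Sy; apply: sub_generated; right.
  have [S0 S1 SI SU SSC] := SS.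
  (* The countable algebra of the push-out is the square of [S]; it contains [(1, 0)] and
     [(0, 1)]. *)
  pose SS2 := [set z : CT *p CT | S (sub_val z.1) /\ S (sub_val z.2)].
  have subSS2 : subalgebra SS2.
    split=> //.
    - by move=> y z [y1 y2] [z1 z2]; split; exact: SI.
    - by move=> y z [y1 y2] [z1 z2]; split; exact: SU.
    - by move=> y [y1 y2]; split; exact: SSC.
  have subv : subalgebra (range v) by apply: subalgebra_image.
  split=> //; exists SS2; split.
    pose f (z : CT *p CT) : BB * BB := (sub_val z.1, sub_val z.2).
    have /card_eqPle[_ fS] : f @` SS2 #= SS2.
      apply: inj_card_eq => -[y1 y2] [z1 z2] _ _ [yz1 yz2].
      by congr (_, _); exact: sub_val_inj.
    apply: sub_countable fS _; apply: sub_countable (countableX Sc Sc).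
    by apply: subset_card_le => _ [z [z1 z2] <-].
  split=> //.
  - set W := generated _; have [W0 W1 WI WU WC] : subalgebra W := generated_subalgebra _.
    have SW : SS2 `<=` W by move=> z Sz; apply: sub_generated; left.
    (* The diagonal of [C] is generated by those of [dom G] and [S]. *)
    have diagW y (Cy : C y) : W (Subalgebra CC Cy, Subalgebra CC Cy).
      pose P := [set y | exists Cy : C y, W (Subalgebra CC Cy, Subalgebra CC Cy)].
      suff : P y by move=> [Cy']; rewrite (Prop_irrelevance Cy' Cy).
      apply: (generated_min _ _ Cy); last first.
        move=> z [[g Gg <-]|Sz].
          by exists (domC _ Gg); apply: sub_generated; right; exists (Subalgebra GG Gg).
        by exists (SC _ Sz); exact: SW.
      split.
      - by exists (sub_valP (\bot%O : CT)); exact: W0.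
      - by exists (sub_valP (\top%O : CT)); exact: W1.
      - move=> y1 y2 [C1 W1'] [C2 W2].
        by exists (sub_valP ((Subalgebra CC C1 : CT) `&` Subalgebra CC C2)%O); exact: (WI _ _ W1' W2).
      - move=> y1 y2 [C1 W1'] [C2 W2].
        by exists (sub_valP ((Subalgebra CC C1 : CT) `|` Subalgebra CC C2)%O); exact: (WU _ _ W1' W2).
      - move=> y1 [C1 W1'].
        by exists (sub_valP (~` (Subalgebra CC C1 : CT))%O); exact: (WC _ W1').
    apply/seteqP; split=> // -[z1 z2] _.
    (* Every pair is assembled from two diagonal elements cut by [(1, 0)] and [(0, 1)]. *)
    have -> : (z1, z2) = (((z1, z1) : CT *p CT) `&` (\top, \bot) `|` (((z2, z2) : CT *p CT) `&` (\bot, \top)))%O.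
      rewrite !meetEprod joinEprod /=.
      by rewrite !meetx1 !meetx0 joinx0 join0x.
    apply: WU; apply: WI; try by [case: z1 => *; exact: diagW|case: z2 => *; exact: diagW].
      exact: SW.
    exact: SW.
  (* A diagonal pair lies below [z] when its entry lies below the meet of the two components, so one
     interpolation in [BB] suffices. *)
  - move=> _ z [g _ <-] [Sz1 Sz2]; rewrite leEprod => /andP[/= gz1 gz2].
    have [|||r [[t Gt tr] Sr gr rz]] := GS (sub_val g).1 (sub_val z.1 `&` sub_val z.2)%O.
    + by exists (sub_val g) => //; exact: sub_valP.
    + exact: SI.
    + by rewrite lexI; apply/andP; split; [exact: gz1|exact: gz2].
    + exists (v (Subalgebra GG Gt)); split.
      * by exists (Subalgebra GG Gt).
      * by split; rewrite /= tr.
      * by rewrite leEprod /=; apply/andP; split; rewrite -tr in gr; exact: gr.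
      * move: rz; rewrite lexI leEprod -tr => /andP[r1 r2].
        by apply/andP; split; [exact: r1|exact: r2].
have Asm : card_lt [set: A] [set: set nat].
  have AG : [set: A] #= G := card_subalgebra_type GG.
  split; last first.
    by apply/negP => /card_eqPle[_ cA]; apply: Gsm; move: AG => /card_eqPle[+ _]; exact: card_le_trans.
  have := card_BB => /card_eqPle[+ _]; apply: card_le_trans.
  apply: (@card_le_trans _ _ _ (dom G)); last exact: card_leT.
  have /card_eqPle[_] : (fun g : A => (sub_val g).1) @` [set: A] #= [set: A].
    by apply: inj_card_eq => g h _ _ gh; apply: vinj; congr (_, _); exact: sub_val_inj.
  move=> /card_le_trans; apply; apply: subset_card_le => _ [g _ <-].
  by exists (sub_val g) => //; exact: sub_valP.
have [w [[w0 w1 wI wU wC] winj] wv] := ext_BB Asm u0E vposex.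
(* The default [\bot] outside [C] is never evaluated. *)
pose u y := if pselect (C y) is left H then
  w (Subalgebra CC H : CT, Subalgebra CC H : CT) else \bot%O.
have uE (z : CT) : u (sub_val z) = w (z, z).
  rewrite /u; case: pselect => [H|]; last by case; exact: sub_valP.
  by congr (w (_, _)); exact: sub_val_inj.
exists u, (w (\top, \bot)%O); split.
- by split; [exact: etrans (uE \bot%O) w0|exact: etrans (uE \top%O) w1].
- move=> y z Cy Cz; rewrite -[y]/(sub_val (Subalgebra CC Cy)) -[z]/(sub_val (Subalgebra CC Cz)).
  by rewrite !uE -wI -uE.
- move=> y Cy; rewrite -[y]/(sub_val (Subalgebra CC Cy)).
  by rewrite !uE -wC -uE.
- move=> z Gz; exact: etrans (uE (k (Subalgebra GG Gz))) (wv (Subalgebra GG Gz)).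
- have wbot z : w z = \bot%O -> z = \bot%O by rewrite -w0 => /winj.
  split=> y Cy.
    rewrite -[y]/(sub_val (Subalgebra CC Cy)) uE.
    by move=> /wbot/(congr1 (fun z => sub_val z.1)).
  rewrite -[y]/(sub_val (Subalgebra CC Cy)) uE; set y' : CT := Subalgebra CC Cy.
  (* As [w] reflects the order, [u y] below [x] puts [(y, y)] below [(1, 0)], and the second
     coordinate gives [y = \bot]; for the complement of [x] the first coordinate does. *)
  have wle a b : (w a <= w b)%O -> (a <= b)%O.
    by rewrite !leEmeet -wI => /eqP/winj->.
  rewrite -wC => /orP[] /wle.
    by rewrite leEprod /= => /andP[_]; rewrite lex0 => /eqP/(congr1 (@sub_val _ _ _ CC)).
  by rewrite leEprod /= => /andP[+ _]; rewrite compl1 lex0 => /eqP/(congr1 (@sub_val _ _ _ CC)).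
Qed.

Lemma dom_generated (H K : set (BB *p BB)) :
  dom (generated (H `|` K)) = generated (dom H `|` dom K).
Proof. by rewrite /dom image_generated ?image_setU //; exact: fst_hom. Qed.

Lemma rng_generated (H K : set (BB *p BB)) :
  rng (generated (H `|` K)) = generated (rng H `|` rng K).
Proof. by rewrite /rng image_generated ?image_setU //; exact: snd_hom. Qed.

(* The image of [S] is first chosen by the extension property and then corrected
   below an element [c] of [q] so small that [c] meets [u s] either fully or not
   at all, whence the correction preserves disjointness from [dom G], and so
   small that no nonzero [u y] lies below [c], whence it preserves injectivity. *)
Lemma forth p q G X : P_point q -> partial_iso p q G -> small G ->
  nice (dom G) -> nice (rng G) -> countable X ->
  exists K, [/\ countable K, partial_iso p q (generated (G `|` K)),
    nice (dom (generated (G `|` K))), nice (rng (generated (G `|` K)))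
    & X `<=` dom (generated (G `|` K))].
Proof.
move=> hq PG Gsm dG rG Xc; have [GG G0 Gev] := PG.
have [S [SS Sc XS GS]] := dG X Xc.
have [u [x [[u0 u1] uI uC uG [uinj ux]]]] := extend_partial_iso PG Gsm SS Sc GS.
set C := generated _ in uI uC uinj ux.
have SC : S `<=` C by move=> y Sy; apply: sub_generated; right.
have GC z : G z -> C z.1 by move=> Gz; apply: sub_generated; left; exists z.
have [CC0 CC1 CCI CCU CCC] : subalgebra C := generated_subalgebra _.
have uU y z : C y -> C z -> u (y `|` z)%O = (u y `|` u z)%O.
  move=> Cy Cz; rewrite -[(y `|` z)%O]complK complU uC; last by apply: CCI; exact: CCC.
  by rewrite uI ?uC //; [ba|exact: CCC|exact: CCC].
have [S0 S1 SI SU SSC] := SS.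
have [c qc [cS cx]] : exists2 c, ev q c & (forall s, S s -> ev q (u s) -> (c <= u s)%O) /\
    (forall y, C y -> (u y <= c)%O -> y = \bot%O).
  have [||c0 /evP qc0 c0S] := @P_point_lower_bound _ _ q (u @` [set s | S s /\ ev q (u s)]) hq.
  - apply: sub_countable (card_image_le _ _) _; apply: sub_countable Sc.
    by apply: subset_card_le => s [].
  - by move=> _ [s [_ /evP]] ? <-.
  (* Either [x] or its complement belongs to [q]; meeting [c0] with that one keeps it in [q]. *)
  have [qx|nqx] := boolP (ev q x).
    exists (c0 `&` x)%O; first by rewrite !evE qc0.
    split=> [s Ss qs|y Cy yc]; last first.
      by apply: ux => //; rewrite (_ : (u y <= x)%O) //; ba.
    by have c0s : (c0 <= u s)%O; [apply: c0S; exists s|ba].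
  exists (c0 `&` ~` x)%O; first by rewrite !evE qc0.
  split=> [s Ss qs|y Cy yc]; last first.
    by apply: ux => //; rewrite (_ : (u y <= ~` x)%O) ?orbT //; ba.
  by have c0s : (c0 <= u s)%O; [apply: c0S; exists s|ba].
have cS' s : S s -> ~~ ev q (u s) -> (c `&` u s = \bot)%O.
  move=> Ss; rewrite -(ev_compl q) -uC; last exact: SC.
  move=> /(cS _ (SSC _ Ss)); rewrite uC; last exact: SC.
  by move=> H; ba.
pose h s : BB := ((u s `&` ~` c) `|` (if ev p s then c else \bot))%O.
pose K := [set ((s, h s) : BB *p BB) | s in S].
have Kc : countable K by apply: sub_countable (card_image_le _ _) Sc.
have KK : subalgebra K.
  split.
  - by exists \bot%O => //; rewrite /h u0 evE; congr (_, _); ba.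
  - by exists \top%O => //; rewrite /h u1 evE; congr (_, _); ba.
  - move=> _ _ [s Ss <-] [t St <-]; exists (s `&` t)%O; first exact: SI.
    rewrite meetEprod; congr (_, _); rewrite /h uI ?evE /=; [|exact: SC|exact: SC].
    by case: (ev p s); case: (ev p t) => /=; ba.
  - move=> _ _ [s Ss <-] [t St <-]; exists (s `|` t)%O; first exact: SU.
    rewrite joinEprod; congr (_, _); rewrite /h uU ?evE /=; [|exact: SC|exact: SC].
    by case: (ev p s); case: (ev p t) => /=; ba.
  - move=> _ [s Ss <-]; exists (~` s)%O; first exact: SSC.
    rewrite complEprod; congr (_, _); rewrite /h uC ?evE /=; [|exact: SC].
    by case: (ev p s) => /=; ba.
(* As [c] is in [q], membership of [h s] in [q] depends only on its part below [c]. *)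
have hq_ev s : S s -> ev p s = ev q (h s).
  by move=> Ss; rewrite /h; case: (ev p s); rewrite !evE qc ?andbF ?orbT.
have PG' : partial_iso p q (generated (G `|` K)).
  split; first exact: generated_subalgebra.
    apply: generated_join_ind => // [|z t z0 t0]; last first.
      by rewrite joinEprod /= !join_eq0 z0 t0.
    move=> [a a'] _ Ga [s Ss <-]; rewrite meetEprod /=.
    have Ca : C a by exact: (GC _ Ga).
    have Cs : C s by exact: SC.
    have ua : u a = a' by exact: (uG _ Ga).
    apply/eqP/eqP => [as0|a0].
      have uas : (a' `&` u s = \bot)%O by rewrite -ua -uI // as0.
      rewrite /h; case: ifP => [ps|_]; last by ba.
      (* Interpolate [r] between [a] and the complement of [s]. As [s] is in [p], [r] is not, so
         [u r] is not in [q] and is disjoint from [c]; but [a'] lies below [u r]. *)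
      suff ac0 : (a' `&` c = \bot)%O by ba.
      have [|||r [[t Gt tr] Sr ar rs]] := GS a (~` s)%O; first by exists (a, a').
      - exact: SSC.
      - by ba.
      have nqr : ~~ ev q (u r).
        rewrite -tr uG // -Gev // tr; apply: contraL ps => pr.
        by move: (ev_le rs p); rewrite evE pr.
      have a'r : (a' <= u r)%O.
        by rewrite -tr uG // -(partial_iso_le PG Ga Gt) tr.
      by move: (cS' _ Sr nqr) a'r; clear; move=> cr ar'; ba.
    (* Since [h s] and [u s] agree outside [c], the image under [u] of the meet of [a] and [s] lies
       below [c]. *)
    apply: cx; first exact: CCI.
    rewrite uI // ua; move: a0; rewrite /h => a0.
    by ba.
  apply: generated_min => [|z [/Gev//|[s Ss <-]]]; last exact: hq_ev.
  split=> [||z t zz tt|z t zz tt|z zz].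
  - by rewrite !evE.
  - by rewrite !evE.
  - by rewrite meetEprod !evE zz tt.
  - by rewrite joinEprod !evE zz tt.
  - by rewrite complEprod !evE zz.
have domK : dom K = S by apply/seteqP; split=> [_ [_ [s Ss <-] <-]|s Ss] //; exists (s, h s) => //; exists s.
exists K; split=> //.
- rewrite dom_generated domK; apply: nice_generated => //.
  by apply: subalgebra_image => //; exact: fst_hom.
- rewrite rng_generated; apply: nice_generated => //.
  + by apply: subalgebra_image => //; exact: snd_hom.
  + by apply: subalgebra_image => //; exact: snd_hom.
  + by apply: sub_countable (card_image_le _ _) _.
- by rewrite dom_generated domK => y /XS Sy; apply: sub_generated; right.
Qed.

(** * Inverse graphs and the back step *)

Definition inv G : set (BB *p BB) := (fun z => (z.2, z.1)) @` G.

Lemma inv_image_in G z : G z -> inv G (z.2, z.1).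
Proof. by move=> Gz; exists z. Qed.

Lemma invK G : inv (inv G) = G.
Proof.
apply/seteqP; split=> [_ [_ [z Gz <-] <-]|z Gz]; first by rewrite -surjective_pairing.
by exists (z.2, z.1); [exact: inv_image_in|rewrite /= -surjective_pairing].
Qed.

Lemma dom_inv G : dom (inv G) = rng G.
Proof. by rewrite /dom /rng /inv image_comp. Qed.

Lemma rng_inv G : rng (inv G) = dom G.
Proof. by rewrite -dom_inv invK. Qed.

Lemma inv_generated (H K : set (BB *p BB)) :
  inv (generated (H `|` K)) = generated (inv H `|` inv K).
Proof. by rewrite /inv (image_generated (@swap_hom _ _ BB BB)) image_setU. Qed.

Lemma partial_iso_inv p q G : partial_iso p q G -> partial_iso q p (inv G).
Proof.
move=> [GG G0 Gev]; split; first by apply: subalgebra_image => //; exact: swap_hom.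
  by move=> _ [z /G0 + <-].
by move=> _ [z /Gev + <-].
Qed.

(** The invariant of a single countable extension: niceness of domain and range survives it, while
    membership in a skeleton is regained only after infinitely many extensions. *)
Definition extendible p q G :=
  [/\ partial_iso p q G, small G, nice (dom G) & nice (rng G)].

Lemma extendible_inv p q G : extendible p q G -> extendible q p (inv G).
Proof.
move=> [PG Gsm dG rG]; split; rewrite ?dom_inv ?rng_inv //.
  exact: partial_iso_inv.
exact: small_image.
Qed.

Lemma extendible_forth p q G X : P_point q -> extendible p q G -> countable X ->
  exists K, [/\ countable K, extendible p q (generated (G `|` K))
    & X `<=` dom (generated (G `|` K))].
Proof.
move=> hq [PG Gsm dG rG] Xc; have [K [Kc PK dK rK XK]] := forth hq PG Gsm dG rG Xc.
exists K; split=> //; split=> //; apply: small_generated => //.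
by apply: smallU => //; exact: small_countable.
Qed.

(** Inverting the graph exchanges [p] with [q] and domain with range, which reduces this to the
    forth step. *)
Lemma extendible_back p q G X : P_point p -> extendible p q G -> countable X ->
  exists K, [/\ countable K, extendible p q (generated (G `|` K))
    & X `<=` rng (generated (G `|` K))].
Proof.
move=> hp /extendible_inv eG Xc; have [K [Kc eK XK]] := extendible_forth hp eG Xc.
have invE : generated (G `|` inv K) = inv (generated (inv G `|` K)).
  by rewrite inv_generated invK.
exists (inv K); split; first exact: sub_countable (card_image_le _ _) Kc.
  by rewrite invE; exact: extendible_inv.
by rewrite invE rng_inv.
Qed.

Lemma extendible_back_and_forth p q G X Y : P_point p -> P_point q ->
  extendible p q G -> countable X -> countable Y ->
  exists K, [/\ countable K, extendible p q (generated (G `|` K)),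
    X `<=` dom (generated (G `|` K)) & Y `<=` rng (generated (G `|` K))].
Proof.
move=> hp hq eG Xc Yc; have [K [Kc eK XK]] := extendible_forth hq eG Xc.
have [L [Lc eL YL]] := extendible_back hp eK Yc.
exists (K `|` L); rewrite setUA -generated_setUl; split=> //; first exact: countableU.
apply: subset_trans XK _; apply: image_subset; apply: subset_trans (@sub_generated _ _ _).
exact: subsetUl.
Qed.

Lemma partial_iso_chain p q (C : set (set (BB *p BB))) : C !=set0 ->
  (forall G, C G -> partial_iso p q G) -> total_on C subset ->
  partial_iso p q (\bigcup_(G in C) G).
Proof.
move=> C0 CP Ctot; split.
- by apply: subalgebra_chain => // G /CP[].
- by move=> z [G /CP[_ G0 _] Gz]; exact: G0.
- by move=> z [G /CP[_ _ Gev] Gz]; exact: Gev.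
Qed.

(** * Transfinite back and forth along the skeleton *)

Variable F : set (set BB).
Hypothesis skF : skeleton F.

Lemma skeleton_nice A : F A -> nice A.
Proof.
have [Fsub _ Fcov Fint] := skF; move=> FA X Xc.
by have [N [FN Nc XN]] := Fcov X Xc; exists N; split=> //; [exact: Fsub|exact: Fint].
Qed.

Definition good p q G := [/\ partial_iso p q G, F (dom G) & F (rng G)].

(** The domain of the union is generated by the domains, and the skeleton is closed under such
    joins; likewise for the range. *)
Lemma good_chain p q (C : set (set (BB *p BB))) : C !=set0 ->
  (forall G, C G -> good p q G) -> total_on C subset ->
  good p q (\bigcup_(G in C) G).
Proof.
have [Fsub Fcup _ _] := skF; move=> C0 CG Ctot.
have PC : partial_iso p q (\bigcup_(G in C) G).
  by apply: partial_iso_chain => // G /CG[].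
have [CC _ _] := PC.
have image_cup (f : BB *p BB -> BB) : boolean_hom f -> (forall G, C G -> F (f @` G)) ->
    F (f @` \bigcup_(G in C) G).
  move=> fhom CF; rewrite -(subalgebra_generated (subalgebra_image fhom CC)).
  rewrite image_bigcup -(bigcup_image C (fun G => f @` G) id).
  by apply: Fcup => _ [G /CF + <-].
split=> //; apply: image_cup; [exact: fst_hom| |exact: snd_hom|] => G /CG[] //.
Qed.

(** Countable extensions are iterated along the natural numbers, each absorbing into domain and
    range countable skeleton members that cover the generators added before. In the limit, domain
    and range are generated by the original ones and countably many skeleton members, hence lie in
    [F]. *)
Lemma good_extension p q G0 X Y : P_point p -> P_point q -> good p q G0 ->
  small G0 -> countable X -> countable Y ->
  exists G, [/\ good p q G, small G, G0 `<=` G, X `<=` dom G & Y `<=` rng G].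
Proof.
have [Fsub Fcup Fcov Fint] := skF.
move=> hp hq [PG0 dG0 rG0] smG0 Xc Yc.
have /choice[cov covP] (Z : set BB) : exists N, countable Z -> [/\ F N, countable N & Z `<=` N].
  have [/Fcov[N HN]|nZ] := pselect (countable Z); first by exists N.
  by exists set0.
pose gen K := generated (G0 `|` K).
pose state := {K | countable K /\ extendible p q (gen K)}.
(* With [X] included, the first extension already puts it into the domain. *)
pose dcov K := cov (X `|` dom K).
pose rcov K := cov (Y `|` rng K).
have dcovP K : countable K -> [/\ F (dcov K), countable (dcov K) & X `|` dom K `<=` dcov K].
  by move=> Kc; apply: covP; apply: countableU => //; exact: sub_countable (card_image_le _ _) Kc.
have rcovP K : countable K -> [/\ F (rcov K), countable (rcov K) & Y `|` rng K `<=` rcov K].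
  by move=> Kc; apply: covP; apply: countableU => //; exact: sub_countable (card_image_le _ _) Kc.
have /choice[nxt nxtP] (K : state) : exists L : state, [/\ sval K `<=` sval L,
    dcov (sval K) `<=` dom (gen (sval L)) & rcov (sval K) `<=` rng (gen (sval L))].
  case: K => K [Kc eK] /=.
  have [_ dc _] := dcovP _ Kc; have [_ rc _] := rcovP _ Kc.
  have [L [Lc]] := extendible_back_and_forth hp hq eK dc rc.
  rewrite generated_setUl -setUA => eL dL rL.
  by exists (exist _ (K `|` L) (conj (countableU Kc Lc) eL)); split=> //; exact: subsetUl.
have eG0 : extendible p q (gen set0).
  rewrite /gen setU0 subalgebra_generated; last by case: PG0.
  by split=> //; exact: skeleton_nice.
pose s n : state := iter n nxt (exist _ set0 (conj (@countable0 _) eG0)).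
pose K n := sval (s n).
have Kc n : countable (K n) by case: (svalP (s n)).
have KE n : extendible p q (gen (K n)) by case: (svalP (s n)).
have KS n : [/\ K n `<=` K n.+1, dcov (K n) `<=` dom (gen (K n.+1)) & rcov (K n) `<=` rng (gen (K n.+1))].
  exact: nxtP.
have Kmono m n : (m <= n)%N -> K m `<=` K n.
  elim: n => [|n IH]; first by rewrite leqn0 => /eqP->.
  rewrite leq_eqVlt => /orP[/eqP->//|]; rewrite ltnS => /IH mn.
  by apply: subset_trans mn _; case: (KS n).
have genmono m n : (m <= n)%N -> gen (K m) `<=` gen (K n).
  by move=> mn; apply: generated_mono; apply: setUS; exact: Kmono.
pose G := \bigcup_n gen (K n).
have PG : partial_iso p q G.
  rewrite /G -(bigcup_image setT (fun n => gen (K n)) id); apply: partial_iso_chain.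
  - by exists (gen (K 0%N)), 0%N.
  - by move=> _ [n _ <-]; case: (KE n).
  - by move=> _ _ [m _ <-] [n _ <-]; case: (leqP m n) => [|/ltnW] mn; [left|right]; exact: genmono.
have [GG _ _] := PG.
have F_image (f : BB *p BB -> BB) (c : nat -> set BB) : boolean_hom f ->
    F (f @` G0) -> (forall n, F (c n)) -> (forall n, f @` K n `<=` c n) ->
    (forall n, c n `<=` f @` gen (K n.+1)) -> F (f @` G).
  move=> fhom FG0 Fc Kcn cK.
  have -> : f @` G = generated (\bigcup_(A in [set f @` G0] `|` range c) A).
    apply/seteqP; split.
      rewrite image_bigcup; apply: bigcup_sub => n _.
      rewrite /gen image_generated // image_setU.
      apply: generated_min; first exact: generated_subalgebra.
      rewrite subUset; split; apply: subset_trans (@sub_generated _ _ _).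
        by apply: (bigcup_sup (i := f @` G0) (F := id)); left.
      by apply: subset_trans (Kcn n) _; apply: (bigcup_sup (i := c n) (F := id)); right; exists n.
    apply: generated_min; first exact: subalgebra_image.
    apply: bigcup_sub => A [->|[n _ <-]] /=.
      by apply: image_subset => z Gz; exists 0%N => //; apply: sub_generated; left.
    apply: subset_trans (cK n) _; apply: image_subset.
    exact: (@bigcup_sup _ _ n.+1 setT (fun n => gen (K n))).
  by apply: Fcup => A [->|[n _ <-]]; [exact: FG0|exact: Fc].
exists G; split.
- split=> //.
    apply: (F_image _ (fun n => dcov (K n))) => [|//|n|n|n]; first exact: fst_hom.
    + by case: (dcovP _ (Kc n)).
    + by case: (dcovP _ (Kc n)) => _ _; rewrite subUset => -[].
    + by case: (KS n).
  apply: (F_image _ (fun n => rcov (K n))) => [|//|n|n|n]; first exact: snd_hom.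
  + by case: (rcovP _ (Kc n)).
  + by case: (rcovP _ (Kc n)) => _ _; rewrite subUset => -[].
  + by case: (KS n).
- by apply: small_bigcup => // [|n _]; [exact: small_countable|case: (KE n)].
- by move=> z Gz; exists 0%N => //; apply: sub_generated; left.
- have [_ d1 _] := KS 0%N; have [_ _] := dcovP _ (Kc 0%N); rewrite subUset => -[d0 _].
  apply: subset_trans d0 _; apply: subset_trans d1 _; apply: image_subset.
  exact: (@bigcup_sup _ _ 1%N setT (fun n => gen (K n))).
- have [_ _ d1] := KS 0%N; have [_ _] := rcovP _ (Kc 0%N); rewrite subUset => -[d0 _].
  apply: subset_trans d0 _; apply: subset_trans d1 _; apply: image_subset.
  exact: (@bigcup_sup _ _ 1%N setT (fun n => gen (K n))).
Qed.

Lemma good_trivial p q : good p q (generated set0).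
Proof.
have [_ Fcup _ _] := skF.
have F0 : F (generated set0) by rewrite -(bigcup_set0 id); apply: Fcup.
split; last 2 first.
- by rewrite /dom image_generated ?image_set0 //; exact: fst_hom.
- by rewrite /rng image_generated ?image_set0 //; exact: snd_hom.
split; first exact: generated_subalgebra.
  suff : generated set0 `<=` [set \bot%O; \top%O : BB *p BB] by move=> sG z /sG[]->.
  apply: generated_min => //; split; [by left|by right| | |].
  - by move=> _ _ [->|->] [->|->]; rewrite ?meet0x ?meetx0 ?meetxx; [left|left|left|right].
  - by move=> _ _ [->|->] [->|->]; rewrite ?join1x ?joinx1 ?joinxx; [left|right|right|right].
  - by move=> _ [->|->]; rewrite ?compl0 ?compl1; [right|left].
apply: generated_min => //; split=> [||z t zz tt|z t zz tt|z zz].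
- by rewrite /= !evE.
- by rewrite /= !evE.
- by rewrite meetEprod /= !evE zz tt.
- by rewrite joinEprod /= !evE zz tt.
- by rewrite complEprod /= !evE zz.
Qed.

(* Stage [a] handles the at most one element coded by [a]; initiality of the
   well-order keeps the union of the earlier stages small. *)
Lemma total_good p q : P_point p -> P_point q ->
  exists G, [/\ partial_iso p q G, dom G = setT & rng G = setT].
Proof.
move=> hp hq.
have [f finj] : exists f : BB -> set nat, injective f.
  have /card_eqPle[/pcard_injP[f finj] _] := card_BB.
  by exists f => x y fxy; apply: finj; rewrite ?inE.
pose X (a : set nat) := f @^-1` [set a].
have Xc a : countable (X a).
  have [[b fb]|nb] := pselect (exists b, f b = a).
    suff -> : X a = [set b] by exact: countable1.
    by apply/seteqP; split=> [c|c ->//]; rewrite /X /= -fb => /finj.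
  suff -> : X a = set0 by exact: countable0.
  by apply/seteqP; split=> // b fb; case: nb; exists b.
have /choice[st stP] (Ga : set (BB *p BB) * set nat) : exists G', good p q Ga.1 -> small Ga.1 ->
    [/\ good p q G', small G', Ga.1 `<=` G', X Ga.2 `<=` dom G' & X Ga.2 `<=` rng G'].
  have [[gG sG]|nG] := pselect (good p q Ga.1 /\ small Ga.1).
    by have [G' HG'] := good_extension hp hq gG sG (Xc Ga.2) (Xc Ga.2); exists G'.
  by exists set0 => gG sG; case: nG.
have [R [woR Rinit]] := initial_well_order_exists.
pose lt a b := R a b /\ a <> b.
have wf : well_founded lt := wo_wf woR.
(* The trivial graph is included so that the chain of earlier graphs is nonempty even at the least
   [a]. *)
pose stage a (rec : forall b, lt b a -> set (BB *p BB)) :=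
  st (generated set0 `|` [set z | exists b (ba : lt b a), rec b ba z], a).
pose G := Fix wf (fun=> set (BB *p BB)) stage.
pose C a := [set generated set0] `|` G @` [set b | lt b a].
pose prev a := \bigcup_(H in C a) H.
have GE a : G a = st (prev a, a).
  rewrite /G Fix_eq => [|x g h gh].
    rewrite /stage -/G; congr (st (_, _)); rewrite /prev /C bigcup_setU bigcup_set1 bigcup_image.
    congr (_ `|` _); apply/seteqP; split=> z; first by move=> [b [ba Gz]]; exists b.
    by move=> [b ba Gz]; exists b, ba.
  by congr st; congr (_ `|` _, _); apply/seteqP; split=> z [b [ba gz]]; exists b, ba;
    [rewrite -gh|rewrite gh].
pose stageP a := [/\ good p q (G a), small (G a), prev a `<=` G a, X a `<=` dom (G a) & X a `<=` rng (G a)].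
have Gstage a : stageP a.
  elim: (wf a) => {}a _ IH.
  have gp : good p q (prev a).
    apply: good_chain.
    - by exists (generated set0); left.
    - move=> _ [->|[b ba <-]]; first exact: good_trivial.
      by case: (IH b ba).
    - have G0 b : lt b a -> generated set0 `<=` G b.
        move=> ba; have [_ _ + _ _] := IH b ba; apply: subset_trans.
        by apply: (bigcup_sup (i := generated set0) (F := id)); left.
      have Gm b c : lt c a -> lt b c -> G b `<=` G c.
        move=> ca bc; have [_ _ + _ _] := IH c ca; apply: subset_trans.
        by apply: (bigcup_sup (i := G b) (F := id)); right; exists b.
      move=> _ _ [->|[b ba <-]] [->|[c ca <-]]; [by left|by left; exact: G0|by right; exact: G0|].
      have [->|bc] := pselect (b = c); first by left.
      by have [|] := wo_total woR b c => H; [left|right]; apply: Gm => //; split=> // /esym.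
  have sp : small (prev a).
    apply: small_bigcup => [//||_ [->|[b ba <-]]].
    - apply: smallU => //; first exact: small_countable (countable1 _).
      apply: small_image => Rs; have [] := Rinit a.
      by move=> Ra /negP; apply; apply/card_eqPle; split.
    - by apply/small_countable/countable_generated.
    - by case: (IH b ba).
  have := stP (prev a, a) gp sp; rewrite /= -GE => -[]; split=> //.
pose T := \bigcup_(H in range G) H.
have gT : good p q T.
  apply: good_chain.
  - by exists (G set0), set0.
  - by move=> _ [a _ <-]; case: (Gstage a).
  - have Gm b c : lt b c -> G b `<=` G c.
      move=> bc; have [_ _ + _ _] := Gstage c; apply: subset_trans.
      by apply: (bigcup_sup (i := G b) (F := id)); right; exists b.
    move=> _ _ [b _ <-] [c _ <-].
    have [->|bc] := pselect (b = c); first by left.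
    by have [|] := wo_total woR b c => H; [left|right]; apply: Gm => //; split=> // /esym.
have GT a : G a `<=` T by apply: (bigcup_sup (i := G a) (F := id)); exists a.
exists T; split; first by case: gT.
  apply/seteqP; split=> // b _; have [_ _ _ + _] := Gstage (f b) => /(_ b erefl).
  by apply: image_subset; exact: GT.
apply/seteqP; split=> // b _; have [_ _ _ _ +] := Gstage (f b) => /(_ b erefl).
by apply: image_subset; exact: GT.
Qed.

Lemma automorphism_of_graph p q G : partial_iso p q G -> dom G = setT -> rng G = setT ->
  exists f g : BB -> BB, [/\ boolean_hom f /\ boolean_hom g, cancel f g, cancel g f
    & forall x, ev p x = ev q (f x)].
Proof.
(* Since [H] is single-valued and closed under the operations, [h] respects them. *)
have hom_of (p' q' : Stone BB) H (h : BB -> BB) :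
    partial_iso p' q' H -> (forall x, H (x, h x)) -> boolean_hom h.
  move=> PH Hh; have [[H0 H1 HI HU HC] _ _] := PH.
  have hE z : H z -> h z.1 = z.2 by move=> Hz; exact: (partial_iso_inj PH (Hh z.1) Hz).
  split.
  - exact: (hE _ H0).
  - exact: (hE _ H1).
  - by move=> x y; exact: (hE _ (HI _ _ (Hh x) (Hh y))).
  - by move=> x y; exact: (hE _ (HU _ _ (Hh x) (Hh y))).
  - by move=> x; exact: (hE _ (HC _ (Hh x))).
move=> PG dG rG; have PiG := partial_iso_inv PG.
have /choice[f Gf] x : exists y, G (x, y).
  by have [[x' y] Gz /= <-] : dom G x; [rewrite dG|exists y].
have /choice[g Gg] y : exists x, G (x, y).
  by have [[x y'] Gz /= <-] : rng G y; [rewrite rG|exists x].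
have iGg y : inv G (y, g y) by exists (g y, y).
exists f, g; split.
- by split; [exact: hom_of PG Gf|exact: hom_of PiG iGg].
- move=> x; exact: (partial_iso_inj PiG (iGg (f x)) (inv_image_in (Gf x))).
- move=> y; exact: (partial_iso_inj PG (Gf (g y)) (Gg y)).
- by move=> x; have [_ _ /(_ _ (Gf x))] := PG.
Qed.

End BackAndForth.

(** * Dual maps between Stone spaces *)

Section StoneMap.
Variables (d e : Order.disp_t) (B : ctbDistrLatticeType d) (C : ctbDistrLatticeType e).
Variable f : B -> C.
Hypothesis fhom : boolean_hom f.

Lemma ultrafilter_preimage (r : Stone C) : ba_ultrafilter (f @^-1` stone_set r).
Proof.
have [f0 f1 fI fU fC] := fhom; have [r1 r0 rI rU] := proj1 (stone_setP r).
apply: prime_ultrafilter.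
  split=> /=; first by rewrite f1.
  - by rewrite f0.
  - by move=> x y rx ry; rewrite fI; exact: rI.
  - move=> x y; rewrite leEmeet => /eqP xy; apply: rU.
    by rewrite leEmeet -fI xy.
by move=> x; rewrite /preimage /= fC; exact: ultrafilter_prime (stone_setP r) _.
Qed.

Definition stone_map (r : Stone C) : Stone B := MkStone (ultrafilter_preimage r).

Lemma stone_map_continuous : continuous stone_map.
Proof.
move=> r U /nbhs_stone[a ra aU]; apply: (@filterS _ _ _ (stone_clopen (f a))).
  by move=> s sa; exact: aU.
by apply: open_nbhs_nbhs; split=> //; exact: open_stone_clopen.
Qed.

End StoneMap.

Lemma stone_inj (d : Order.disp_t) (B : ctbDistrLatticeType d) : injective (@stone_set d B).
Proof.
move=> [r rP] [s sP] /= rs; move: rP sP; rewrite rs => rP sP.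
by congr MkStone; exact: Prop_irrelevance.
Qed.

Theorem theorem30
  (c_regular : regular_cardinal (set nat))
  (d : Order.disp_t) (BB : ctbDistrLatticeType d)
  (card_BB : [set: BB] #= [set: set nat])
  (tsf_BB : tightly_sigma_filtered BB)
  (ext_BB : forall (dA dB : Order.disp_t) (A : ctbDistrLatticeType dA)
      (B : ctbDistrLatticeType dB) (u : A -> BB) (v : A -> B),
    card_lt [set: A] [set: set nat] -> embedding u -> posex_embedding v ->
    exists2 u' : B -> BB, embedding u' & forall a, u' (v a) = u a)
  (p q : Stone BB) (hp : P_point p) (hq : P_point q) :
  exists2 f : Stone BB -> Stone BB, homeomorphism f & f p = q.
Proof.
have [F skF] := tightly_sigma_filtered_skeleton tsf_BB.
have [G [PG dG rG]] := total_good c_regular card_BB ext_BB skF hp hq.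
have [f [g [[fhom ghom] fK gK pq]]] := automorphism_of_graph PG dG rG.
(* Duality reverses arrows, hence [g] and not [f]: an element [x] is in the image of [p] when [g x]
   is in [p], that is, when [f (g x) = x] is in [q]. *)
exists (stone_map ghom).
  exists (stone_map fhom); split; try exact: stone_map_continuous.
  - move=> r; apply: stone_inj; apply/seteqP; split=> x; rewrite /= /preimage /= fK //.
  - move=> r; apply: stone_inj; apply/seteqP; split=> x; rewrite /= /preimage /= gK //.
apply: stone_inj; apply/seteqP; split=> x.
  by move=> px; apply/evP; rewrite -[x]gK -pq; exact/evP.
by move=> qx; have /evP : ev p (g x) by rewrite pq gK; exact/evP.
Qed.
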